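(* Let $W\ge1$ be an integer and let $\mathcal H$ be a real Hilbert space of dimension $d\in\{1,2,\ldots\}\cup\{\infty\}$ (written $\mathcal H\cong\mathbb R^d$). Let $\Phi:\mathbb R^W\to\mathcal H$ be differentiable with Lipschitz-continuous differential. Suppose a set $G\subset\mathcal H$ is the image of the $W$-dimensional sphere $\mathbb S^W=\{\mathbf y\in\mathbb R^{W+1}:\|\mathbf y\|=1\}$ under a continuous injective map $g:\mathbb S^W\to\mathcal H$. Then $G\not\subset F_\Phi$.
   Context: For a target $\mathbf f\in\mathcal H$, let $L_{\mathbf f}(\mathbf w)=\frac12\|\mathbf f-\Phi(\mathbf w)\|^2_{\mathcal H}$ and let $\mathbf w(t)$, $t\ge0$, be the (unique, globally defined) solution of the gradient flow $\frac{d\mathbf w}{dt}=-\nabla_{\mathbf w}L_{\mathbf f}(\mathbf w(t))$ with $\mathbf w(0)=\mathbf 0$. The set of GF-learnable targets is $F_\Phi=\{\mathbf f\in\mathcal H:\inf_{t\ge0}L_{\mathbf f}(\mathbf w(t))=0\}$. *)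

(* Defs.v *)
From HB Require Import structures.
From mathcomp Require Import all_boot all_order all_algebra.
From mathcomp Require Import all_classical all_reals all_analysis.
Set Implicit Arguments. Unset Strict Implicit. Unset Printing Implicit Defensive.
Import Order.TTheory GRing.Theory Num.Theory.
Import numFieldNormedType.Exports.
Local Open Scope classical_set_scope.
Local Open Scope ring_scope.

(* A real Hilbert space: a complete normed space (the type V) whose norm is
   induced by a (symmetric, bilinear, hence positive definite) inner product. *)
Definition hilbert_norm (R : realType) (V : completeNormedModType R) : Prop :=
  exists inner : V -> V -> R,
    [/\ (forall x y, inner x y = inner y x),
        (forall a x y z, inner (a *: x + y) z = a * inner x z + inner y z)
      & (forall x, inner x x = `|x| ^+ 2)].

Definition grad (R : realType) (W : nat) (L : 'rV[R]_W -> R) (w : 'rV[R]_W)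
  : 'rV[R]_W := \row_(i < W) 'D_(delta_mx 0 i) L w.

Definition loss (R : realType) (V : completeNormedModType R) (W : nat)
  (Phi : 'rV[R]_W -> V) (f : V) (w : 'rV[R]_W) : R :=
  2^-1 * `|f - Phi w| ^+ 2.

Definition GF_solution (R : realType) (V : completeNormedModType R) (W : nat)
  (Phi : 'rV[R]_W -> V) (f : V) (w : R -> 'rV[R]_W) : Prop :=
  [/\ w 0 = 0,
      w t @[t --> 0^'+] --> w 0
    & forall t : R, 0 < t -> is_derive t 1 w (- grad (loss Phi f) (w t))].

(* F_Phi: targets f such that inf_{t >= 0} L_f(w(t)) = 0 along the
   (unique) gradient-flow trajectory from 0. *)
Definition GF_learnable (R : realType) (V : completeNormedModType R) (W : nat)
  (Phi : 'rV[R]_W -> V) : set V :=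
  [set f | forall w : R -> 'rV[R]_W, GF_solution Phi f w ->
           inf [set loss Phi f (w t) | t in [set t : R | 0 <= t]] = 0].

Definition sphere (R : realType) (W : nat) : set 'rV[R]_(W.+1) :=
  [set y | \sum_(i < W.+1) (y 0 i) ^+ 2 = 1].
Arguments sphere : clear implicits.

(* Main.v *)
(** If every g y were learnable, compactness of the sphere, continuous dependence
    of the flow on its target and monotonicity of the loss would give a single
    time N at which all the losses of the targets g y are below a given e.  The
    map sending y to the parameter reached at time N is continuous from the
    W-sphere to R^W, so by Borsuk-Ulam it takes the same value at some y and - y;
    then g y and g (- y) are both close to one point Phi w, which contradicts the
    positive lower bound of |g y - g (- y)| on the sphere.

    Borsuk-Ulam is proved with chains mod 2 on an iterated barycentric
    subdivision of the cross-polytope.  The signs of the components of an odd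
    map are cochains p_0, ..., p_(n-1); the cup product of their coboundaries
    takes the value 1 on the n-dimensional hemisphere, so some small simplex
    sees a change of sign of every component.

    The flow is obtained by Picard iteration for a field cut off outside a ball
    whose radius grows exponentially in time. *)
Require Import Defs.
From HB Require Import structures.
From mathcomp Require Import all_boot all_order all_algebra.
From mathcomp Require Import all_classical all_reals all_analysis.
From mathcomp Require Import ring lra.
Import Order.TTheory GRing.Theory Num.Theory.
Import numFieldNormedType.Exports.
Local Open Scope classical_set_scope.
Local Open Scope ring_scope.
Set Implicit Arguments. Unset Strict Implicit. Unset Printing Implicit Defensive.

(** * Limits of finite sums and cluster points *)

Lemma cvg_sumr (K : numFieldType) (V : normedModType K) (T : Type)
    (F : set_system T) (FF : Filter F) (I : Type) (r : seq I)
    (f : I -> T -> V) (l : I -> V) : (forall i, f i x @[x --> F] --> l i) ->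
  \sum_(i <- r) f i x @[x --> F] --> \sum_(i <- r) l i.
Proof.
move=> fl; elim: r => [|i r IH].
  under eq_fun do rewrite big_nil; rewrite big_nil; exact: cvg_cst.
under eq_fun do rewrite big_cons; rewrite big_cons; exact: cvgD.
Qed.

(** Stands in for the extraction of a convergent subsequence: every neighbourhood of [p] is visited
    at arbitrarily late indices. *)
Lemma compact_cluster_seq (T : topologicalType) (A : set T) (x : nat -> T) :
  compact A -> (forall n, A (x n)) ->
  exists2 p, A p & forall N U, nbhs p U -> exists2 n, (N <= n)%N & U (x n).
Proof.
move=> Ac Ax; have [|p [Ap px]] := Ac (x @ \oo) _; first by exists 0%N => // k _; exact: Ax.
exists p => // N U pU.
have [|_ [[n Nn <-] Un]] := px (x @` [set n | (N <= n)%N]) U _ pU.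
  by exists N => // n Nn; exists n.
by exists n.
Qed.


(** * Chains and cochains mod 2 *)

Section ModTwoChains.
Variable T : eqType.
Implicit Types (s u : seq T) (c : seq (seq T)) (phi psi : seq T -> bool).

(* A chain mod 2 is a list of simplices; two chains are identified when every
   cochain takes the same value on them.  The empty simplex is allowed, so that
   the complex is augmented. *)
Definition ev phi c : bool := \big[addb/false]_(s <- c) phi s.

(** The cone formula: the boundary of the cone over [s'] with apex [v] is [s'] plus the cone over
    the boundary of [s']. A single vertex has the empty simplex as boundary, which is the
    augmentation. *)
Fixpoint bd s : seq (seq T) :=
  if s is v :: s' then s' :: [seq v :: u | u <- bd s'] else [::].

Definition cobd phi s : bool := ev phi (bd s).

Lemma ev_nil phi : ev phi [::] = false.
Proof. exact: big_nil. Qed.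

Lemma ev_cons phi s c : ev phi (s :: c) = phi s (+) ev phi c.
Proof. exact: big_cons. Qed.

Lemma ev_cat phi c1 c2 : ev phi (c1 ++ c2) = ev phi c1 (+) ev phi c2.
Proof. exact: big_cat. Qed.

Lemma ev_map phi (f : seq T -> seq T) c : ev phi (map f c) = ev (phi \o f) c.
Proof. exact: big_map. Qed.

Lemma ev_flatten_map phi (f : seq T -> seq (seq T)) c :
  ev phi (flatten (map f c)) = ev (fun s => ev phi (f s)) c.
Proof. by rewrite /ev big_flatten big_map. Qed.

Lemma ev_addb phi psi c :
  ev (fun s => phi s (+) psi s) c = ev phi c (+) ev psi c.
Proof. exact: big_split. Qed.

Lemma eq_ev phi psi c : phi =1 psi -> ev phi c = ev psi c.
Proof. by move=> e; apply: eq_bigr => s _; exact: e. Qed.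

Lemma eq_in_ev phi psi c : {in c, phi =1 psi} -> ev phi c = ev psi c.
Proof. by move=> e; apply: eq_big_seq => s /e. Qed.

Lemma ev_false c : ev (fun=> false) c = false.
Proof. by rewrite /ev big1. Qed.

Lemma ev_andl b phi c : ev (fun s => b && phi s) c = b && ev phi c.
Proof. by case: b => //; exact: ev_false. Qed.

Lemma size_bd s u : u \in bd s -> size s = (size u).+1.
Proof.
elim: s u => [//|v s IH] u /=; rewrite inE => /orP[/eqP->//|/mapP[r rs ->]] /=.
by rewrite (IH _ rs).
Qed.

Lemma sub_bd s u : u \in bd s -> {subset u <= s}.
Proof.
elim: s u => [//|v s IH] u /=; rewrite inE => /orP[/eqP-> x xs|/mapP[r rs ->] x].
  by rewrite inE xs orbT.
by rewrite !inE => /orP[->//|/(IH _ rs) ->]; rewrite orbT.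
Qed.

Lemma map_bd (f : T -> T) s : bd (map f s) = map (map f) (bd s).
Proof.
elim: s => //= v s ->; congr cons.
by rewrite -!map_comp; apply: eq_map => u.
Qed.

Lemma cobd_cons phi v s : cobd phi (v :: s) = phi s (+) cobd (phi \o cons v) s.
Proof. by rewrite /cobd /= ev_cons ev_map. Qed.

Lemma ev_cobd_cone phi v c :
  ev (cobd phi) [seq v :: u | u <- c] =
  ev phi c (+) ev (cobd (phi \o cons v)) c.
Proof.
by rewrite ev_map -ev_addb; apply: eq_ev => u /=; rewrite cobd_cons.
Qed.

(** Splitting off the first vertex twice by the cone formula, [cobd phi s] appears two times and
    cancels mod 2; what remains is the same claim for [phi \o cons v] on [s]. *)
Lemma cobd_cobd phi s : cobd (cobd phi) s = false.
Proof.
elim: s phi => [|v s IH] phi; first exact: ev_nil.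
rewrite cobd_cons (_ : cobd (_ \o _) s =
    cobd (fun u => phi u (+) cobd (phi \o cons v) u) s); last first.
  by apply: eq_ev => u /=; rewrite cobd_cons.
by rewrite {2}/cobd ev_addb -/(cobd phi s) -/(cobd (cobd _) s) IH addbF addbb.
Qed.

(** * Barycentric subdivision and the hemispheres *)

Section Subdivision.
Variable bary : seq T -> T.

(* Barycentric subdivision; m is the number of vertices of s and serves as fuel. *)
Fixpoint sd m s : seq (seq T) :=
  if m is m'.+1 then [seq bary s :: u | u <- flatten (map (sd m') (bd s))]
  else [:: [::]].

Lemma sdS m s :
  sd m.+1 s = [seq bary s :: u | u <- flatten (map (sd m) (bd s))].
Proof. by []. Qed.

(** Subdivision is a chain map, in dual form. The boundary of the cone from the barycenter over the
    subdivided boundary is its base plus the cone over the boundary of the base; by induction the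
    latter subdivides the boundary of a boundary, so it vanishes. *)
Lemma ev_cobd_sd m phi s : size s = m.+1 ->
  ev (cobd phi) (sd m.+1 s) = cobd (fun u => ev phi (sd m u)) s.
Proof.
elim: m phi s => [|m IH] phi s ss; rewrite sdS ev_cobd_cone !ev_flatten_map.
  case: s ss => [//|x [|//]] _.
  by rewrite /= /cobd /= !ev_cons !ev_nil !addbF.
rewrite -/(cobd (fun u => ev phi (sd m.+1 u)) s).
rewrite [X in _ (+) X](_ : _ = false) ?addbF//.
rewrite -[RHS](cobd_cobd (fun u => ev (phi \o cons (bary s)) (sd m u)) s).
by apply: eq_in_ev => u /size_bd; rewrite ss => -[/esym su]; rewrite -IH.
Qed.

Lemma size_sd m s u : size s = m -> u \in sd m s -> size u = m.
Proof.
elim: m s u => [|m IH] s u ss /=; first by rewrite inE => /eqP->.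
move=> /mapP[r /flattenP[c /mapP[t tbd ->] rt] ->] /=; congr S.
by apply: IH rt; have := size_bd tbd; rewrite ss => -[].
Qed.

(** Serves for convex conditions [C]: lying in a ball, or in a face of the cross-polytope. *)
Lemma all_sd (C : pred T) m s u :
  (forall r, (0 < size r)%N -> {subset r <= s} -> all C r -> C (bary r)) ->
  size s = m -> all C s -> u \in sd m s -> all C u.
Proof.
elim: m s u => [|m IH] s u Cb ss Cs /=; first by rewrite inE => /eqP->.
move=> /mapP[r /flattenP[c /mapP[t tbd ->] rt] ->] /=; apply/andP; split.
  by apply: Cb; rewrite ?ss.
have ts := sub_bd tbd.
apply: IH rt.
- by move=> v v0 vt; apply: Cb => // x /vt/ts.
- by have := size_bd tbd; rewrite ss => -[].
- by apply/allP => x /ts; exact: (allP Cs).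
Qed.

Lemma map_sd (f : T -> T) m s : (forall r, bary (map f r) = f (bary r)) ->
  sd m (map f s) = map (map f) (sd m s).
Proof.
move=> fb; elim: m s => [//|m IH] s; rewrite !sdS map_bd fb.
rewrite [flatten _](_ : _ = map (map f) (flatten (map (sd m) (bd s)))).
  by rewrite -!map_comp; apply: eq_map.
by rewrite map_flatten -!map_comp; congr flatten; apply: eq_map => u /=.
Qed.

Variables (a : T -> T) (e : nat -> T).

(* The upper k-dimensional hemisphere of the cross-polytope with vertices e i
   and a (e i). *)
Fixpoint hemi k : seq (seq T) :=
  if k is k'.+1 then [seq e k :: u | u <- hemi k' ++ map (map a) (hemi k')]
  else [:: [:: e 0]].

Definition sdhemi N k : seq (seq T) :=
  iter N (fun c => flatten (map (sd k.+1) c)) (hemi k).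

Hypothesis aK : involutive a.
Hypothesis bary_a : forall r, bary (map a r) = a (bary r).

Lemma size_hemi k s : s \in hemi k -> size s = k.+1.
Proof.
elim: k s => [|k IH] s /=; first by rewrite inE => /eqP->.
move=> /mapP[u]; rewrite mem_cat => /orP[/IH su|/mapP[r /IH su ->]] -> /=.
  by rewrite su.
by rewrite size_map su.
Qed.

Lemma size_sdhemi N k s : s \in sdhemi N k -> size s = k.+1.
Proof.
elim: N s => [|N IH] s; first exact: size_hemi.
by move=> /flattenP[c /mapP[t /IH st ->]]; exact: size_sd.
Qed.

Lemma cobd_map phi s : cobd phi (map a s) = cobd (phi \o map a) s.
Proof. by rewrite /cobd map_bd ev_map. Qed.

Lemma hemiS k :
  hemi k.+1 = [seq e k.+1 :: u | u <- hemi k ++ map (map a) (hemi k)].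
Proof. by []. Qed.

(** The hemisphere is a cone over the sphere made of the lower hemisphere and its antipode. That
    sphere has no boundary: by induction each half is bounded by the same sphere, invariant under
    [a], and the two copies cancel mod 2. *)
Lemma ev_cobd_hemi k phi :
  ev (cobd phi) (hemi k.+1) = ev phi (hemi k) (+) ev (phi \o map a) (hemi k).
Proof.
elim: k phi => [|k IH] phi; rewrite hemiS ev_cobd_cone !ev_cat !(ev_map _ (map a)).
  by rewrite /cobd /= !ev_cons !ev_nil /= /cobd /= !ev_cons !ev_nil /= !addbF addbb addbF.
set psi := phi \o cons _.
rewrite (_ : ev (cobd psi \o map a) _ =
    ev (cobd (psi \o map a)) (hemi k.+1)); last first.
  by apply: eq_ev => u; exact: cobd_map.
rewrite !IH (_ : ev ((psi \o map a) \o map a) (hemi k) = ev psi (hemi k)).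
  by case: (ev phi _); case: (ev (phi \o map _) _); case: (ev psi _); case: (ev (psi \o map _) _).
by apply: eq_ev => u /=; rewrite (mapK aK).
Qed.

(** The unsubdivided case carries over because subdivision commutes with the boundary and with
    [a]. *)
Lemma ev_cobd_sdhemi N k phi :
  ev (cobd phi) (sdhemi N k.+1) =
  ev phi (sdhemi N k) (+) ev (phi \o map a) (sdhemi N k).
Proof.
elim: N phi => [|N IH] phi; first exact: ev_cobd_hemi.
rewrite [sdhemi _ _]iterS -/(sdhemi N k.+1) ev_flatten_map.
rewrite (@eq_in_ev _ (cobd (fun u => ev phi (sd k.+1 u)))); last first.
  by move=> s /size_sdhemi ss; exact: ev_cobd_sd.
rewrite IH /sdhemi !iterS -/(sdhemi N k) !ev_flatten_map; congr (_ (+) _).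
by apply: eq_ev => s; rewrite -ev_map -map_sd.
Qed.

(** * The cup product of the sign cochains *)

Variable p : nat -> T -> bool.

(* The cup product of the coboundaries of p (k-1), ..., p 0. *)
Fixpoint signcup k s : bool :=
  match k, s with
  | 0, _ => true
  | k'.+1, x :: ((y :: _) as s') => (p k' x (+) p k' y) && signcup k' s'
  | _, _ => false
  end.

(** The cup product of the 0-cochain [p k] with [signcup k]; it serves as a primitive of
    [signcup k.+1]. *)
Definition thetacup k s : bool :=
  if s is x :: _ then p k x && signcup k s else false.

(** A cup product of coboundaries is a cocycle. Only the faces opposite to [x] and to [y] are
    treated apart; the others start with [x], [y], share the factor [p k x (+) p k y], and are
    summed by induction. *)
Lemma cobd_signcup k s : size s = k.+2 -> cobd (signcup k) s = false.
Proof.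
elim: k s => [|k IH] s.
  by case: s => [//|x [//|y [|//]]] _; rewrite /cobd /= !ev_cons ev_nil.
case: s => [//|x [//|y [//|z s]]] [ss].
have {}IH : cobd (signcup k \o cons y) (z :: s) = signcup k (z :: s).
  have := IH (y :: z :: s); rewrite /= ss => /(_ erefl).
  by rewrite cobd_cons; case: (signcup k _) => //=; case: (cobd _ _).
rewrite 2!cobd_cons.
rewrite (_ : cobd _ (z :: s) = (p k x (+) p k y) && signcup k (z :: s)).
  by rewrite /=; case: (signcup _ _); case: (p k x); case: (p k y); case: (p k z).
by rewrite -[in RHS]IH -ev_andl; apply: eq_ev.
Qed.

(** The faces that keep [x] share the factor [p k x], and since [signcup k] is a cocycle they sum to
    [p k x && signcup k (y :: s)]; the face opposite to [x] contributes the same with [p k y]. *)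
Lemma cobd_thetacup k s : size s = k.+2 -> cobd (thetacup k) s = signcup k.+1 s.
Proof.
case: s => [//|x [//|y s]] ss; have := cobd_signcup ss.
rewrite !cobd_cons.
rewrite (_ : cobd (thetacup k \o _ \o _) s =
   p k x && cobd (signcup k \o cons x \o cons y) s); last first.
  by rewrite -ev_andl; apply: eq_ev.
rewrite /=; set b := cobd _ _.
by case: (signcup k (x :: s)); case: (signcup k (y :: s)); case: b;
  case: (p k x); case: (p k y).
Qed.

(** The points where the signs are odd: the nonzero vectors in the application, as no boolean sign
    can be odd at 0. *)
Variable D : pred T.
Hypothesis p_a : forall k x, D x -> p k (a x) = ~~ p k x.

Lemma signcup_map k s : all D s -> signcup k (map a s) = signcup k s.
Proof.
elim: k s => [//|k IH] [//|x [//|y s]] /= /and3P[Dx Dy Ds].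
rewrite !p_a// -[a y :: map a s]/(map a (y :: s)) IH /= ?Dy//.
by case: (p k x); case: (p k y).
Qed.

Lemma signcup_change k s : size s = k.+1 -> signcup k s ->
  forall i, (i < k)%N -> exists x y, [/\ x \in s, y \in s & p i x != p i y].
Proof.
elim: k s => [//|k IH] [//|x [//|y s]] [ss] /= /andP[pxy ps] i.
rewrite ltnS leq_eqVlt => /orP[/eqP->|ik].
  exists x, y; rewrite !inE !eqxx orbT; split => //.
  by move: pxy; case: (p k x); case: (p k y).
have [u [v [us vs puv]]] := IH (y :: s) (congr1 S ss) ps i ik.
by exists u, v; split => //; rewrite inE ?us ?vs orbT.
Qed.

(* On the boundary of the k.+1-hemisphere, thetacup k is summed over the
   k-hemisphere and its antipode; as p k is odd and signcup k is even, the two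
   contributions add up to the value of signcup k on the k-hemisphere. *)
Lemma ev_signcup_sdhemi N k :
  (forall j, (j <= k)%N -> all (all D) (sdhemi N j)) ->
  ev (signcup k) (sdhemi N k) = true.
Proof.
elim: k => [_|k IH DN].
  (* Base case: the 0-hemisphere is one vertex, and subdividing a vertex yields one vertex. *)
  have : size (sdhemi N 0) = 1.
    elim: N => [//|N IH]; rewrite /sdhemi iterS -/(sdhemi N 0).
    have := @size_sdhemi N 0.
    case: (sdhemi N 0) IH => [//|s [|//]] _ /(_ s); rewrite inE eqxx => /(_ erefl).
    by case: s => [//|x [|]].
  by case: (sdhemi N 0) => [//|s [|//]] _; rewrite ev_cons ev_nil.
rewrite -IH; last by move=> j jk; apply: DN; exact: ltnW.
rewrite -(@eq_in_ev (cobd (thetacup k))); last first.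
  by move=> s /size_sdhemi; exact: cobd_thetacup.
rewrite ev_cobd_sdhemi -ev_addb; apply: eq_in_ev => s sN.
have Ds := allP (DN k (leqnSn k)) _ sN.
case: s Ds {sN} (size_sdhemi sN) => [//|x s] Ds _ /=.
rewrite -[a x :: map a s]/(map a (x :: s)) signcup_map//.
have /andP[Dx _] := Ds.
by rewrite p_a//; case: (signcup k _); case: (p k x).
Qed.

Lemma exists_signcup N k :
  (forall j, (j <= k)%N -> all (all D) (sdhemi N j)) ->
  exists2 s, s \in sdhemi N k & signcup k s.
Proof.
move=> /ev_signcup_sdhemi; case: (boolP (has (signcup k) (sdhemi N k))).
  by move=> /hasP[s sN ps] _; exists s.
move=> /hasPn np; rewrite (@eq_in_ev _ (fun=> false)) ?ev_false// => s /np.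
exact: negbTE.
Qed.

End Subdivision.
End ModTwoChains.

(** * Geometry of the cross-polytope and its subdivisions *)

Section CrossPolytope.
Variables (R : realType) (n : nat).
Local Notation E := 'rV[R]_n.+1.
Implicit Types (x y z : E) (s u : seq E).

Definition barycenter s : E := (size s)%:R^-1 *: \sum_(x <- s) x.

Lemma barycenter_opp s : barycenter (map -%R s) = - barycenter s.
Proof. by rewrite /barycenter size_map big_map sumrN scalerN. Qed.

Definition linform (c : 'I_n.+1 -> R) x : R := \sum_i c i * x 0 i.

Lemma linform_barycenter c s :
  linform c (barycenter s) = (size s)%:R^-1 * \sum_(x <- s) linform c x.
Proof.
rewrite /linform exchange_big mulr_sumr; apply: eq_bigr => i _ /=.
by rewrite mxE summxE mulrCA mulr_sumr.
Qed.

Lemma barycenter_coord s i :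
  barycenter s 0 i = (size s)%:R^-1 * \sum_(x <- s) x 0 i.
Proof. by rewrite mxE summxE. Qed.

Lemma barycenter_dist s z c : (0 < size s)%N ->
  (forall x, x \in s -> `|z - x| <= c) -> `|z - barycenter s| <= c.
Proof.
move=> s0 sc; have sN : (size s)%:R != 0 :> R by rewrite pnatr_eq0 -lt0n.
have -> : z - barycenter s = (size s)%:R^-1 *: \sum_(x <- s) (z - x).
  rewrite sumrB scalerBr big_const_seq count_predT iter_addr addr0.
  by rewrite -(scaler_nat (size s) z) scalerA mulVf// scale1r.
rewrite normrZ normfV normr_nat ler_pdivrMl ?ltr0n//.
apply: le_trans (ler_norm_sum _ _ _) _.
rewrite mulr_natl -[s in X in _ *+ X]filter_predT size_filter -sum1_count.
rewrite -sumrMnr.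
by rewrite big_seq_cond [leRHS]big_seq_cond; apply: ler_sum => x /andP[xs _];
  rewrite mulr1n sc.
Qed.

(** In the mean of the differences [y - x] the vertex [x] itself contributes 0, which gains the
    factor [(m - 1) / m] for [m] vertices. *)
Lemma barycenter_vertex_dist s x d : 0 <= d -> x \in s ->
  (forall y, y \in s -> `|y - x| <= d) ->
  `|barycenter s - x| <= (size s).-1%:R / (size s)%:R * d.
Proof.
move=> d0 xs sd; have s0 : (0 < size s)%N by case: s xs {sd}.
have sN : (size s)%:R != 0 :> R by rewrite pnatr_eq0 -lt0n.
have -> : barycenter s - x = (size s)%:R^-1 *: \sum_(y <- s) (y - x).
  rewrite sumrB scalerBr big_const_seq count_predT iter_addr addr0.
  by rewrite -(scaler_nat (size s) x) scalerA mulVf// scale1r.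
rewrite normrZ normfV normr_nat mulrAC mulrC.
rewrite ler_pM2r ?invr_gt0 ?ltr0n//.
rewrite (big_rem x)//= subrr add0r -(size_rem xs).
apply: le_trans (ler_norm_sum _ _ _) _.
rewrite mulr_natl -sum1_size -sumrMnr.
rewrite big_seq_cond [leRHS]big_seq_cond; apply: ler_sum => y /andP[ys _].
by rewrite mulr1n sd// (mem_rem ys).
Qed.

Definition mesh_le d s := forall x y, x \in s -> y \in s -> `|x - y| <= d.

(** A pair of vertices either contains the barycenter of [s], which is close to all vertices of [s]
    and by convexity to all points of the subdivision, or lies in the subdivision of a face, where
    induction applies. *)
Lemma mesh_sd m s u d : (m <= n.+1)%N -> size s = m -> mesh_le d s ->
  u \in sd barycenter m s -> mesh_le (n%:R / n.+1%:R * d) u.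
Proof.
elim: m s u => [|m IH] s u mn ss sdd; first by rewrite inE => /eqP->.
rewrite sdS => /mapP[r /flattenP[c /mapP[t tbd ->] rt] ->].
have ts := sub_bd tbd.
have tm : size t = m by have := size_bd tbd; rewrite ss => -[].
have d0 : 0 <= d.
  by case: s ss sdd {tbd ts} => [//|x s] _ /(_ x x); rewrite inE eqxx subrr
    normr0; exact.
set k := n%:R / n.+1%:R * d.
have k0 : 0 <= k by rewrite mulr_ge0// divr_ge0.
have bk : {in r, forall x, `|barycenter s - x| <= k}.
  have Cs : all (fun x => `|barycenter s - x| <= k) s.
    apply/allP => y ys; apply: le_trans (barycenter_vertex_dist d0 ys _) _.
      by move=> z zs; exact: sdd.
    (* As [m <= n], the ratio [m / (m + 1)] is at most [n / (n + 1)], so one factor serves all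
       dimensions. *)
    rewrite ss /= ler_wpM2r// ler_pdivrMr ?ltr0n// mulrAC ler_pdivlMr ?ltr0n//.
    rewrite -!natrM ler_nat; move: mn; rewrite ltnS => mn.
    by rewrite !mulnS [(n * m)%N]mulnC leq_add2r.
  apply/allP; apply: all_sd tm _ rt.
    by move=> v v0 _ /allP Cv; exact: barycenter_dist.
  by apply/allP => y /ts; exact: (allP Cs).
have rk : mesh_le k r.
  apply: IH rt => //; first exact: ltnW.
  by move=> x y /ts xs /ts ys; exact: sdd.
move=> x y; rewrite !inE => /orP[/eqP->|xr] /orP[/eqP->|yr].
- by rewrite subrr normr0.
- exact: bk.
- by rewrite distrC; exact: bk.
- exact: rk.
Qed.

Definition basis_vec (j : nat) : E := delta_mx 0 (inord j).

(** The closed face of the cross-polytope in the orthant with signs [eps]. Its conditions are linear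
    and so pass to barycenters, unlike the equation of [l1sphere]. *)
Definition in_face (eps : nat -> bool) : pred E := fun x =>
  [forall i : 'I_n.+1, 0 <= (-1) ^+ eps i * x 0 i] &&
  (linform (fun i => (-1) ^+ eps i) x == 1).

Lemma in_face_barycenter eps s : (0 < size s)%N -> all (in_face eps) s ->
  in_face eps (barycenter s).
Proof.
move=> s0 /allP sf; have sN : (size s)%:R != 0 :> R by rewrite pnatr_eq0 -lt0n.
apply/andP; split.
  apply/forallP => i; rewrite barycenter_coord mulrCA mulr_ge0 ?invr_ge0//.
  rewrite mulr_sumr big_seq; apply: sumr_ge0 => x xs.
  by have /andP[/forallP] := sf _ xs.
rewrite linform_barycenter (eq_big_seq (fun=> 1)); last first.
  by move=> x /sf/andP[_ /eqP].
by rewrite big_const_seq count_predT iter_addr addr0 mulVf.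
Qed.

(** There is one vertex on each axis, never two antipodal ones, so the simplex lies in a single
    orthant. *)
Lemma hemi_vertices k s : s \in hemi -%R basis_vec k -> exists eps : nat -> bool,
  s = [seq (-1) ^+ eps j *: basis_vec j | j <- rev (iota 0 k.+1)].
Proof.
elim: k s => [|k IH] s.
  by rewrite inE => /eqP->; exists xpred0; rewrite /= expr0 scale1r.
rewrite hemiS => /mapP[u uk ->].
have revS : rev (iota 0 k.+2) = k.+1 :: rev (iota 0 k.+1).
  by rewrite -[k.+2]addn1 iotaD rev_cat /= add0n.
suff [eps ->] : exists eps : nat -> bool,
    u = [seq (-1) ^+ eps j *: basis_vec j | j <- rev (iota 0 k.+1)].
  (* The new apex has sign +, so [eps] is reset to [false] at [k.+1]. *)
  exists (fun j => (j != k.+1) && eps j).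
  rewrite revS map_cons eqxx expr0 scale1r; congr cons.
  apply/eq_in_map => j; rewrite mem_rev mem_iota add0n => /andP[_ jk].
  by rewrite ltn_eqF.
move: uk; rewrite mem_cat => /orP[/IH//|/mapP[r /IH[eps ->] ->]].
exists (fun j => ~~ eps j); rewrite -map_comp; apply: eq_map => j /=.
by rewrite -scaleNr; case: (eps j); rewrite ?expr0 ?expr1 ?opprK.
Qed.

Lemma hemi_in_face k s : (k <= n)%N -> s \in hemi -%R basis_vec k ->
  exists eps, all (in_face eps) s.
Proof.
move=> kn /hemi_vertices[eps ->]; exists eps; apply/allP => x /mapP[j].
rewrite mem_rev mem_iota add0n => /andP[_ jk] ->.
have jn : (j < n.+1)%N by exact: leq_trans jk _.
have E1 (i : 'I_n.+1) :
    (-1) ^+ eps i * ((-1) ^+ eps j *: basis_vec j) 0 i = (i == inord j)%:R :> R.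
  rewrite !mxE eqxx /=; have [->|_] := eqVneq i; last by rewrite !mulr0.
  by rewrite inordK// mulr1 -expr2 sqrr_sign.
apply/andP; split; first by apply/forallP => i; rewrite E1.
rewrite /linform (eq_bigr _ (fun i _ => E1 i)) (bigD1 (inord j))//= eqxx.
by rewrite big1 ?addr0// => i /negbTE->.
Qed.

Lemma sdhemi_in_face N k s : (k <= n)%N ->
  s \in sdhemi barycenter -%R basis_vec N k -> exists eps, all (in_face eps) s.
Proof.
move=> kn; elim: N s => [|N IH] s; first exact: hemi_in_face.
move=> /flattenP[c /mapP[t tN ->] st]; have [eps teps] := IH _ tN.
exists eps; apply: all_sd teps st; last exact: size_sdhemi tN.
by move=> r r0 _; exact: in_face_barycenter.
Qed.

Definition l1sphere : set E := [set x | \sum_i `|x 0 i| = 1].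

Lemma in_face_l1sphere eps x : in_face eps x -> l1sphere x.
Proof.
move=> /andP[/forallP x0 /eqP]; rewrite /l1sphere /= => <-.
apply: eq_bigr => i _; rewrite -[RHS]ger0_norm//.
by rewrite normrM normrX normrN1 expr1n mul1r.
Qed.

Lemma l1sphere_neq0 x : l1sphere x -> x != 0.
Proof.
apply: contraPneq => ->; rewrite /l1sphere /= big1 ?(eqP (oner_neq0 R))//.
  by move=> /esym/eqP; rewrite oner_eq0.
by move=> i _; rewrite mxE normr0.
Qed.

Lemma l1sphere_norm x : l1sphere x -> `|x| <= 1.
Proof.
move=> x1; rewrite [leLHS]/Num.norm /= mx_normrE; apply/bigmax_leP; split=> // -[i j] _.
rewrite -x1 (bigD1 j)//= (ord1 i) lerDl; exact: sumr_ge0.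
Qed.

Lemma l1sphere_opp x : l1sphere x -> l1sphere (- x).
Proof.
by rewrite /l1sphere /= => <-; apply: eq_bigr => i _; rewrite mxE normrN.
Qed.

Lemma l1sphere_compact : compact l1sphere.
Proof.
apply: bounded_closed_compact.
  exists 1; split => // M M1 x /l1sphere_norm x1; exact: le_trans x1 (ltW M1).
apply: (@preimage_closed _ _ (fun x : E => \sum_i `|x 0 i|) [set x | x = 1]).
  move=> x _; apply: (@cvg_sumr _ _ _ (nbhs x) _ _ _ (fun i (x : E) => `|x 0 i|)).
  by move=> i; apply: cvg_norm; exact: coord_continuous.
exact: closed_eq.
Qed.

Lemma sdhemi_mesh N s : s \in sdhemi barycenter -%R basis_vec N n ->
  mesh_le ((n%:R / n.+1%:R) ^+ N * 2) s.
Proof.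
elim: N s => [|N IH] s.
  rewrite expr0 mul1r => sN x y xs ys.
  have [eps /allP sf] := sdhemi_in_face (leqnn n) (sN : s \in sdhemi _ _ _ 0 n).
  apply: le_trans (ler_normB _ _) _.
  by rewrite (_ : 2 = 1 + 1 :> R)// lerD// l1sphere_norm//;
    exact: in_face_l1sphere (sf _ _).
move=> /flattenP[c /mapP[t tN ->] st]; rewrite exprS -mulrA.
by apply: mesh_sd st => //; [exact: size_sdhemi tN|exact: IH].
Qed.

(* Breaks ties for the sign at the zeros of an odd function. *)
Definition lexpos x : bool :=
  if [pick i | x 0 i != 0] is Some i then 0 < x 0 i else false.

Lemma lexpos_opp x : x != 0 -> lexpos (- x) = ~~ lexpos x.
Proof.
move=> x0; rewrite /lexpos.
rewrite (eq_pick (_ : _ =1 (fun i => x 0 i != 0))); last first.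
  by move=> i; rewrite mxE oppr_eq0.
case: pickP => [i xi|x00].
  by rewrite mxE oppr_gt0 -leNgt le_eqVlt (negbTE xi).
by move: x0; rewrite (_ : x = 0) ?eqxx//; apply/rowP => i; rewrite mxE;
  apply/eqP/negbFE/x00.
Qed.

Definition signb (f : E -> R) x : bool := (0 < f x) || (f x == 0) && lexpos x.

Lemma signb_opp f x : f (- x) = - f x -> x != 0 -> signb f (- x) = ~~ signb f x.
Proof.
move=> fx x0; rewrite /signb fx lexpos_opp// oppr_gt0 oppr_eq0.
by case: ltgtP.
Qed.

Lemma signb_ge0 f x : signb f x -> 0 <= f x.
Proof. by move=> /orP[/ltW//|/andP[/eqP->]]. Qed.

Lemma signb_le0 f x : ~~ signb f x -> f x <= 0.
Proof. by rewrite negb_or -leNgt => /andP[]. Qed.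

(** A discrete form of Borsuk-Ulam: a simplex on which the cup product is true sees both signs of
    every component. Since ties at zeros are broken arbitrarily, only weak inequalities result. *)
Lemma odd_sign_changes (F : nat -> E -> R) (N : nat) :
  (forall i x, F i (- x) = - F i x) ->
  exists s : seq E, [/\ (0 < size s)%N, {in s, forall x, l1sphere x},
    mesh_le ((n%:R / n.+1%:R) ^+ N * 2) s &
    forall i, (i < n)%N ->
      exists x y, [/\ x \in s, y \in s, 0 <= F i x & F i y <= 0]].
Proof.
move=> Fodd; pose p i := signb (F i).
have inS k s : (k <= n)%N -> s \in sdhemi barycenter -%R basis_vec N k ->
    {in s, forall x, l1sphere x}.
  move=> kn sN x xs; have [eps /allP seps] := sdhemi_in_face kn sN.
  exact: in_face_l1sphere (seps _ xs).
have [s sN sp] : exists2 s, s \in sdhemi barycenter -%R basis_vec N n &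
    signcup p n s.
  apply: (@exists_signcup _ _ _ _ opprK _ p (fun x => x != 0)).
  - exact: barycenter_opp.
  - by move=> k x; exact: signb_opp.
  - move=> j jn; apply/allP => s sN; apply/allP => x xs.
    exact: l1sphere_neq0 (inS _ _ jn sN _ xs).
have ss := size_sdhemi sN.
exists s; split; [by rewrite ss|exact: inS sN|exact: sdhemi_mesh|].
move=> i /(signcup_change ss sp)[x [y [xs ys]]].
case: (boolP (p i x)) => px; case: (boolP (p i y)) => py // _.
- by exists x, y; split => //; [exact: signb_ge0|exact: signb_le0].
- by exists y, x; split => //; [exact: signb_ge0|exact: signb_le0].
Qed.

End CrossPolytope.

(** * The Borsuk-Ulam theorem *)

Lemma odd_common_zero (R : realType) (n : nat) (F : nat -> 'rV[R]_n.+1 -> R) :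
  (forall i x, F i (- x) = - F i x) ->
  (forall i x, l1sphere x -> F i y @[y --> within (@l1sphere R n) (nbhs x)] --> F i x) ->
  exists2 x, l1sphere x & forall i, (i < n)%N -> F i x = 0.
Proof.
move=> Fodd Fc.
have [s sP] := choice (fun N => odd_sign_changes N Fodd).
pose x N := head 0 (s N).
have xs N : x N \in s N.
  by rewrite /x; case: (sP N); case: (s N) => //= a u _ _ _ _; rewrite inE eqxx.
have xK N : l1sphere (x N) by have [_ sK _ _] := sP N; exact: sK.
(* At a cluster point of ever smaller simplices each [F i] must vanish: a strict sign would persist
   nearby, while both weak signs occur arbitrarily close. *)
have [p Kp px] := compact_cluster_seq (@l1sphere_compact R n) xK.
have near_p i r : (i < n)%N -> 0 < r -> exists u w,
    [/\ l1sphere u /\ l1sphere w, `|p - u| < r, `|p - w| < r,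
        0 <= F i u & F i w <= 0].
  move=> ni r0.
  have c1 : `|n%:R / n.+1%:R : R| < 1.
    by rewrite ger0_norm ?divr_ge0// ltr_pdivrMr ?ltr0n// mul1r ltr_nat.
  (* The mesh is at most twice [c ^+ N], hence below [r / 2], and the head of the simplex is within
     [r / 2] of [p]. *)
  have r4 : 0 < r / 4 by rewrite divr_gt0.
  have [N0 _ N0r] := cvgr0_norm_lt _ (cvg_expr c1) _ r4.
  have r2 : 0 < r / 2 by rewrite divr_gt0.
  have [N NN0 pz] := px N0 _ (nbhsx_ballx p _ r2).
  have [_ sK smesh schange] := sP N.
  have pr y : y \in s N -> `|p - y| < r.
    move=> ys; rewrite -(subrKA (x N)); apply: le_lt_trans (ler_normD _ _) _.
    have {}pz : `|p - x N| < r / 2 by move: pz; rewrite -ball_normE.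
    have := smesh _ _ (xs N) ys; have := N0r N NN0.
    rewrite /= ger0_norm ?exprn_ge0 ?divr_ge0//.
    set c := (_ / _) ^+ N; lra.
  have [u [w [us ws u0 w0]]] := schange i ni.
  by exists u, w; split; [split; exact: sK|exact: pr|exact: pr| |].
exists p => // i ni; apply/eqP; case: (ltgtP (F i p) 0) => // Fp; exfalso.
- have : \forall y \near p, l1sphere y -> F i y < 0.
    exact: cvgr_lt (Fc i p Kp) _ Fp.
  move=> /nbhs_ballP[r /= r0 pr].
  have [u [w [[Ku _] pu _ Fu _]]] := near_p i r ni r0.
  by have := pr u; rewrite -ball_normE /= => /(_ pu Ku); rewrite ltNge Fu.
- have : \forall y \near p, l1sphere y -> F i y > 0.
    exact: cvgr_gt (Fc i p Kp) _ Fp.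
  move=> /nbhs_ballP[r /= r0 pr].
  have [u [w [[_ Kw] _ pw _ Fw]]] := near_p i r ni r0.
  by have := pr w; rewrite -ball_normE /= => /(_ pw Kw); rewrite ltNge Fw.
Qed.

Lemma continuous_coord_within (R : realType) (T : topologicalType) (A : set T)
    (n : nat) (f : T -> 'rV[R]_n) (x : T) (i : 'I_n) :
  {within A, continuous f} -> A x ->
  f y 0 i @[y --> within A (nbhs x)] --> f x 0 i.
Proof.
move=> /subspace_continuousP fc /fc fx.
exact: continuous_cvg (@coord_continuous _ _ _ 0 i (f x)) fx.
Qed.

Lemma cvg_withinP (T U : topologicalType) (A : set T) (B : set U) (f : T -> U)
    (x : T) : f y @[y --> x] --> f x -> (forall y, A y -> B (f y)) ->
  f y @[y --> within A (nbhs x)] --> within B (nbhs (f x)).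
Proof.
move=> fx AB P PB.
have fP : \forall y \near x, B (f y) -> P (f y) := fx _ PB.
suff : \forall y \near x, A y -> P (f y) by [].
by apply: filterS fP => y Py /AB; exact: Py.
Qed.

Lemma sphere_opp (R : realType) (n : nat) (x : 'rV[R]_n.+1) : sphere R n x -> sphere R n (- x).
Proof.
by rewrite /sphere /= => <-; apply: eq_bigr => i _; rewrite mxE sqrrN.
Qed.

(** The odd radial map [nu] carries the boundary of the cross-polytope to the round sphere, and the
    components of [h (nu x) - h (nu (- x))] are odd functions of [x]. *)
Theorem borsuk_ulam (R : realType) (n : nat) (h : 'rV[R]_n.+1 -> 'rV[R]_n) :
  {within sphere R n, continuous h} ->
  exists2 y, sphere R n y & h y = h (- y).
Proof.
move=> hc; pose E := 'rV[R]_n.+1.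
pose q (x : E) : R := \sum_i x 0 i ^+ 2.
pose nu (x : E) : E := (Num.sqrt (q x))^-1 *: x.
have q_gt0 x : l1sphere x -> 0 < q x.
  move=> /l1sphere_neq0 x0; rewrite lt_def sumr_ge0 ?andbT; last first.
    by move=> i _; exact: sqr_ge0.
  apply: contra x0; rewrite psumr_eq0; last by move=> i _; exact: sqr_ge0.
  move=> /allP q0; apply/eqP/rowP => i; rewrite mxE; apply/eqP.
  by rewrite -sqrf_eq0; apply: q0; rewrite mem_index_enum.
have nuS x : l1sphere x -> sphere R n (nu x).
  move=> /q_gt0 qx; rewrite /sphere /= /nu.
  under eq_bigr do rewrite mxE exprMn exprVn sqr_sqrtr ?(ltW qx)//.
  by rewrite -mulr_sumr mulVf// gt_eqF.
have nuN x : nu (- x) = - nu x.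
  by rewrite /nu scalerN /q; under eq_bigr do rewrite mxE sqrrN.
have nuc x : l1sphere x -> nu y @[y --> nbhs x] --> nu x.
  move=> Kx; apply: cvgZ; last exact: cvg_id.
  apply: cvgV; first by rewrite gt_eqF// sqrtr_gt0 q_gt0.
  apply: continuous_cvg; first exact: sqrt_continuous.
  apply: (@cvg_sumr _ _ _ (nbhs x) _ _ _ (fun i (x : E) => x 0 i ^+ 2)) => i.
  by rewrite expr2; under eq_fun do rewrite expr2;
    apply: cvgM; exact: coord_continuous.
(* Components are indexed by [nat] here; those beyond [n] are set to 0. *)
pose F i (x : E) : R :=
  if insub i is Some j then h (nu x) 0 j - h (nu (- x)) 0 j else 0.
have [| |x Kx Fx] := @odd_common_zero R n F.
- move=> i x; rewrite /F; case: insubP => [j _ _|_]; last by rewrite oppr0.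
  by rewrite opprK opprB.
- move=> i x Kx; rewrite /F; case: insubP => [j _ _|_]; last exact: cvg_cst.
  have nuw := cvg_withinP (nuc x Kx) nuS.
  have nuwN : nu (- y) @[y --> within (@l1sphere R n) (nbhs x)] -->
      within (sphere R n) (nbhs (nu (- x))).
    apply: (@cvg_withinP _ _ _ _ (fun y : E => nu (- y))).
      by rewrite nuN; under eq_fun do rewrite nuN; exact: cvgN (nuc x Kx).
    by move=> y /l1sphere_opp; exact: nuS.
  apply: cvgB.
    by move=> P /(continuous_coord_within hc (nuS x Kx))/nuw.
  have KNx := nuS _ (l1sphere_opp Kx).
  by move=> P /(continuous_coord_within hc KNx)/nuwN.
exists (nu x); first exact: nuS.
apply/rowP => j; apply/eqP; rewrite -subr_eq0; apply/eqP.
by have := Fx j (ltn_ord j); rewrite /F insubT //= => jn; rewrite nuN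
  (_ : Sub _ _ = j)//; exact: val_inj.
Qed.

(** * Calculus on the real line *)

Section RealCalculus.
Variable R : realType.
Implicit Types (f g df dg : R -> R) (a b t : R).

Lemma derive_ge0_le f df a b : a <= b -> continuous f ->
  (forall t, a < t < b -> is_derive t 1 f (df t)) ->
  (forall t, a < t < b -> 0 <= df t) -> f a <= f b.
Proof.
rewrite le_eqVlt => /orP[/eqP->//|ab] fc fd df0.
have fd' x : x \in `]a, b[ -> is_derive x 1 f (df x).
  by rewrite in_itv; exact: fd.
have [c cab e] := MVT ab fd' (continuous_subspaceT fc).
rewrite -subr_ge0 e mulr_ge0 ?subr_ge0 ?(ltW ab)// df0//.
Qed.

(** Both [g + f] and [g - f] have nonnegative derivatives. *)
Lemma mean_value_le f df g dg a b : a <= b -> continuous f -> continuous g ->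
  (forall t, a < t < b -> is_derive t 1 f (df t)) ->
  (forall t, a < t < b -> is_derive t 1 g (dg t)) ->
  (forall t, a < t < b -> `|df t| <= dg t) -> `|f b - f a| <= g b - g a.
Proof.
move=> ab fc gc fd gd dfg; rewrite ler_norml; apply/andP; split.
  rewrite lerNl opprB -subr_ge0.
  suff : g a + f a <= g b + f b by lra.
  apply: (@derive_ge0_le (g \+ f) (dg \+ df)) => //.
  - by move=> x; apply: cvgD; [exact: gc|exact: fc].
  - by move=> t tab; apply: is_deriveD; [exact: gd|exact: fd].
  - by move=> t /dfg /=; rewrite ler_norml => /andP[]; lra.
suff : g a - f a <= g b - f b by lra.
apply: (@derive_ge0_le (g \- f) (dg \- df)) => //.
- by move=> x; apply: cvgB; [exact: gc|exact: fc].
- by move=> t tab; apply: is_deriveB; [exact: gd|exact: fd].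
- by move=> t /dfg /=; rewrite ler_norml => /andP[]; lra.
Qed.

Lemma cvg_maxr (T : Type) (F : set_system T) (FF : Filter F) (u v : T -> R) a b :
  u x @[x --> F] --> a -> v x @[x --> F] --> b ->
  Num.max (u x) (v x) @[x --> F] --> Num.max a b.
Proof.
move=> ua vb; under eq_fun do rewrite maxr_absE; rewrite maxr_absE.
apply: cvgMl; apply: cvgD; first exact: cvgD.
by apply: cvg_norm; exact: cvgB.
Qed.

(** Integrating from -1 makes 0 an interior point, so [G1] is continuous there; composing with
    [Num.max t 0] then freezes [G] at negative times. *)
Lemma exists_antiderivative f : continuous f -> exists G : R -> R,
  [/\ continuous G, forall t, t <= 0 -> G t = 0 &
      forall t, 0 < t -> is_derive t 1 G (f t)].
Proof.
move=> fc; pose G1 (x : R) : R := (\int[lebesgue_measure]_(t in `[-1, x]) f t)%R.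
have G1d (x : R) : -1 < x -> is_derive x 1 G1 (f x).
  move=> x1; have [||||G1d <-] := @continuous_FTC1_closed R f (-1) x (x + 1).
  - by rewrite ltrDl.
  - apply: continuous_compact_integrable; first exact: segment_compact.
    exact: continuous_subspaceT.
  - exact: x1.
  - exact: fc.
  by rewrite derive1E; exact: derivableP.
exists (fun t => G1 (Num.max t 0) - G1 0); split.
- move=> t; apply: cvgB; last exact: cvg_cst.
  have t1 : -1 < Num.max t 0 by rewrite lt_max ltrN10 orbT.
  have G1c : {for Num.max t 0, continuous G1}.
    by apply/differentiable_continuous/derivable1_diffP; have [] := G1d _ t1.
  have mc : Num.max s 0 @[s --> t] --> Num.max t 0.
    by apply: cvg_maxr; [exact: cvg_id|exact: cvg_cst].
  by move=> P /G1c/mc.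
- by move=> t t0; rewrite max_r// subrr.
- move=> t t0; apply: (@near_eq_is_derive _ _ _ (fun s => G1 s - G1 0)).
    by near=> s; rewrite max_l//; near: s; exact: lt_le_nbhsr.
  rewrite -[f t]subr0; apply: is_deriveB.
  by apply: G1d; exact: lt_trans t0.
Unshelve. all: by end_near.
Qed.

Lemma le_geometric_le0 (x K : R) : (forall n, x <= K / 2 ^+ n) -> x <= 0.
Proof.
move=> xK; have h1 : `|2^-1 : R| < 1 by rewrite ger0_norm ?invr_ge0//; lra.
have c0 : K * 2^-1 ^+ n @[n --> \oo] --> K * 0.
  by apply: cvgMr; exact: cvg_expr.
rewrite -(mulr0 K); apply: (@ler_cvg_to _ _ _ _ (fun=> x) _ x _ (cvg_cst _) c0).
by near=> n; rewrite exprVn.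
Unshelve. all: by end_near.
Qed.

(** The intervals of radius [2 * C / 2 ^+ n] about [u n] are nested, and the supremum of their left
    ends lies in all of them. The explicit rate later gives uniform convergence. *)
Lemma geometric_limit (u : nat -> R) (C : R) :
  (forall n, `|u n.+1 - u n| <= C / 2 ^+ n) ->
  exists l, forall n, `|l - u n| <= 2 * C / 2 ^+ n.
Proof.
move=> uC; pose a n := u n - 2 * C / 2 ^+ n; pose b n := u n + 2 * C / 2 ^+ n.
have C0 : 0 <= C by have := uC 0%N; rewrite expr0 divr1; exact: le_trans.
have half n : 2 * C / 2 ^+ n.+1 = C / 2 ^+ n.
  by rewrite exprS invfM mulrACA mulfV// mul1r.
have twice n : 2 * C / 2 ^+ n = C / 2 ^+ n + C / 2 ^+ n by rewrite -mulrA mulr_natl.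
have aS n : a n <= a n.+1.
  by have := uC n; rewrite ler_norml /a half twice => /andP[]; lra.
have bS n : b n.+1 <= b n.
  by have := uC n; rewrite ler_norml /b half twice => /andP[]; lra.
have ab n m : a n <= b m.
  have ak k : a n <= a (n + k)%N.
    by elim: k => [|k IH]; rewrite ?addn0// addnS; exact: le_trans IH (aS _).
  have bk k : b (m + k)%N <= b m.
    by elim: k => [|k IH]; rewrite ?addn0// addnS; exact: le_trans (bS _) IH.
  apply: le_trans (ak m) _; rewrite addnC; apply: le_trans (bk n).
  rewrite /a /b.
  have : 0 <= 2 * C / 2 ^+ (m + n) by rewrite divr_ge0 ?mulr_ge0 ?exprn_ge0.
  lra.
have ha : has_sup (range a).
  split; first by exists (a 0%N), 0%N.
  by exists (b 0%N) => _ [n _ <-].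
exists (sup (range a)) => n; rewrite ler_norml; apply/andP; split.
  have : a n <= sup (range a) by apply: ub_le_sup; [case: ha|exists n].
  by rewrite /a; lra.
have : sup (range a) <= b n.
  by apply: ge_sup; [case: ha|move=> _ [m _ <-]].
by rewrite /b; lra.
Qed.

End RealCalculus.

(** * Limits, derivatives and antiderivatives of row vectors *)

Section RowVectors.
Variables (R : realType) (n : nat).
Local Notation E := 'rV[R]_n.
Implicit Types (x y : E) (i : 'I_n).

Lemma coord_le_norm x i : `|x 0 i| <= `|x|.
Proof.
rewrite [leRHS]/Num.norm /= mx_normrE.
by apply/bigmax_geP; right => /=; exists (0, i).
Qed.

Lemma rV_norm_le x (c : R) : 0 <= c -> (forall i, `|x 0 i| <= c) -> `|x| <= c.
Proof.
move=> c0 xc; rewrite [leLHS]/Num.norm /= mx_normrE.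
by apply/bigmax_leP; split => // -[i j] _ /=; rewrite (ord1 i).
Qed.

Lemma cvg_rV (T : Type) (F : set_system T) (FF : Filter F) (f : T -> E) (l : E) :
  (forall i, f t 0 i @[t --> F] --> l 0 i) -> f t @[t --> F] --> l.
Proof.
move=> fl; apply/cvgrPdist_le => e e0.
have : \forall t \near F, forall i, `|l 0 i - f t 0 i| <= e.
  by apply: filter_forall => i; move/cvgrPdist_le: (fl i); exact.
apply: filterS => t lf; apply: rV_norm_le; first exact: ltW.
by move=> i; rewrite !mxE.
Qed.

Lemma cvg_coord (T : Type) (F : set_system T) (FF : Filter F) (f : T -> E)
  (l : E) i : f t @[t --> F] --> l -> f t 0 i @[t --> F] --> l 0 i.
Proof. by move=> fl; exact: continuous_cvg (@coord_continuous _ _ _ 0 i l) fl. Qed.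

Lemma is_derive_rV (w : R -> E) (dw : E) (t : R) :
  is_derive t 1 w dw <->
  forall i, is_derive t 1 (fun s => w s 0 i) (dw 0 i).
Proof.
split=> [[wd <-] i|wi].
  have /derivable_mxP wid := wd; rewrite derive_mx// mxE.
  exact: derivableP.
have wd : derivable w t 1.
  by apply/derivable_mxP => i j; rewrite (ord1 i); have [] := wi j.
apply: DeriveDef => //; rewrite derive_mx//; apply/rowP => j; rewrite mxE.
by have [] := wi j.
Qed.

(** Continuity is assumed after the existential so that [choice] yields an operator defined on all
    functions; discontinuous ones get a dummy value. *)
Lemma exists_antiderivative_rV (f : R -> E) : exists G : R -> E,
  continuous f -> [/\ continuous G, forall t : R, t <= 0 -> G t = 0 &
      forall t : R, 0 < t -> is_derive t 1 G (f t)].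
Proof.
have [fc|nfc] := pselect (continuous f); last by exists f.
have /choice[G GP] : forall i, exists G : R -> R,
  [/\ continuous G, forall t : R, t <= 0 -> G t = 0 &
      forall t : R, 0 < t -> is_derive t 1 G (f t 0 i)].
  by move=> i; apply: exists_antiderivative => t; apply: cvg_coord; exact: fc.
exists (fun t => \row_i G i t) => _; split.
- move=> t; apply: cvg_rV => i; rewrite mxE; under eq_fun do rewrite mxE.
  by have [Gc _ _] := GP i; exact: Gc.
- by move=> t t0; apply/rowP => i; rewrite !mxE; have [_ -> //] := GP i.
- move=> t t0; apply/is_derive_rV => i; under eq_fun do rewrite mxE.
  by have [_ _] := GP i; exact.
Qed.

End RowVectors.

(** * Global solutions by Picard iteration *)

Section Picard.
Variables (R : realType) (n : nat).
Local Notation E := 'rV[R]_n.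
Variable X : R -> E -> E.
Hypothesis X_cont : forall w : R -> E, continuous w ->
  continuous (fun t => X t (w t)).
Hypothesis X_lip : forall T : R, 0 < T -> exists2 L, 0 < L &
  forall (t : R) u v, 0 < t < T -> `|X t u - X t v| <= L * `|u - v|.

Lemma picard_global : exists w : R -> E, [/\ w 0 = 0, continuous w &
  forall t : R, 0 < t -> is_derive t 1 w (X t (w t))].
Proof.
have [A AP] := choice (@exists_antiderivative_rV R n).
pose wn := fix wn k : R -> E :=
  if k is k'.+1 then A (fun t => X t (wn k' t)) else fun=> 0.
have wnS k : wn k.+1 = A (fun t => X t (wn k t)) by [].
have wnc k : continuous (wn k).
  elim: k => [|k IH]; first by move=> t; exact: cvg_cst.
  by rewrite wnS; have [] := AP _ (X_cont IH).
have wn0 k (t : R) : t <= 0 -> wn k t = 0.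
  case: k => [//|k]; rewrite wnS; have [_ + _] := AP _ (X_cont (wnc k)); exact.
have wnd k (t : R) : 0 < t -> is_derive t 1 (wn k.+1) (X t (wn k t)).
  by have [_ _] := AP _ (X_cont (wnc k)); exact.
have coordc (f : R -> E) i : continuous f -> continuous (fun t => f t 0 i).
  by move=> fc t; apply: cvg_coord; exact: fc.
have step (T : R) : 0 < T -> exists2 C, 0 <= C &
    forall k (t : R), t <= T -> `|wn k.+1 t - wn k t| <= C / 2 ^+ k.
  move=> T0; have [L L0 XL] := X_lip T0.
  have nc : {within `[0, T], continuous (fun t => `|wn 1%N t|)}.
    by apply: continuous_subspaceT => t; apply: cvg_norm; exact: wnc.
  have [c _ cM] := EVT_max (ltW T0) nc.
  pose M := `|wn 1%N c|.
  have M0 : 0 <= M by exact: normr_ge0.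
  have expd (a t : R) : is_derive t 1 (fun s => a * expR (2 * L * s))
      (a * (2 * L * expR (2 * L * t))).
    have h : is_derive t 1 (fun s => 2 * L * s) (2 * L).
      have := is_deriveZ (2 * L) (is_derive_id t (1 : R)).
      by rewrite /GRing.scale /= mulr1.
    have := is_deriveZ a (is_derive1_comp (is_derive_expR _) h).
    by rewrite /GRing.scale /= [expR _ * _]mulrC.
  have expc (a : R) : continuous (fun s => a * expR (2 * L * s)).
    by move=> t; apply/differentiable_continuous/derivable1_diffP;
      have [] := expd a t.
  (* The weight expR (2 * L * t) makes the Picard map contract by 1/2, whatever T. *)
  have dM k (t : R) : 0 <= t <= T ->
      `|wn k.+1 t - wn k t| <= M / 2 ^+ k * expR (2 * L * t).
    elim: k t => [|k IH] t /andP[t0 tT].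
      rewrite expr0 divr1 subr0; apply: (@le_trans _ _ M).
        by apply: cM; rewrite in_itv /= t0.
      apply: ler_peMr; first exact: normr_ge0.
      by rewrite -[leLHS]expR0 ler_expR !mulr_ge0// ltW.
    apply: rV_norm_le => [|i].
      by rewrite mulr_ge0 ?expR_ge0// divr_ge0 ?exprn_ge0.
    set a := M / 2 ^+ k.+1; set f := fun s => wn k.+2 s 0 i - wn k.+1 s 0 i.
    have f0 : f 0 = 0 by rewrite /f !wn0// subrr.
    have fa : `|f t - f 0| <= a * expR (2 * L * t) - a * expR (2 * L * 0).
      apply: (@mean_value_le R f (fun s => X s (wn k.+1 s) 0 i - X s (wn k s) 0 i)
        (fun s => a * expR (2 * L * s))
        (fun s => a * (2 * L * expR (2 * L * s))) 0 t t0) => //.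
      - by move=> s; apply: cvgB; apply: coordc.
      - move=> s /andP[s0 _]; apply: is_deriveB.
          by have /is_derive_rV := wnd k.+1 s s0; exact.
        by have /is_derive_rV := wnd k s s0; exact.
      - move=> s /andP[s0 st].
        have sT : s < T by exact: lt_le_trans tT.
        have := coord_le_norm (X s (wn k.+1 s) - X s (wn k s)) i.
        rewrite !mxE => /le_trans; apply.
        apply: le_trans (XL s _ _ _) _; first by rewrite s0.
        have -> : a * (2 * L * expR (2 * L * s)) =
            L * (M / 2 ^+ k * expR (2 * L * s)).
          by rewrite /a exprS; field; rewrite expf_neq0.
        by rewrite ler_pM2l// IH// (ltW s0) ltW.
    rewrite [X in `|X|](_ : _ = f t - f 0); last by rewrite f0 subr0 !mxE.
    apply: le_trans fa _; rewrite mulr0 expR0 mulr1 gerBl.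
    by rewrite divr_ge0 ?exprn_ge0.
  exists (M * expR (2 * L * T)); first by rewrite mulr_ge0 ?expR_ge0.
  move=> k t tT; have [t0|/ltW t0] := leP 0 t; last first.
    by rewrite !wn0// subrr normr0 divr_ge0 ?exprn_ge0// mulr_ge0 ?expR_ge0.
  apply: le_trans (dM k t _) _; first by rewrite t0.
  rewrite mulrAC ler_pM2r ?invr_gt0 ?exprn_gt0// ler_wpM2l//.
  by rewrite ler_expR ler_pM2l// mulr_gt0.
(* Pointwise limits first, coordinate by coordinate; here the constant may depend on [t]. *)
have lim (t : R) : exists l : E, exists C, forall k, `|l - wn k t| <= C / 2 ^+ k.
  have [C C0 CP] := step (Num.max t 1) ltac:(by rewrite lt_max ltr01 orbT).
  have /choice[l lP] i : exists l, forall k, `|l - wn k t 0 i| <= 2 * C / 2 ^+ k.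
    apply: geometric_limit => k.
    have := coord_le_norm (wn k.+1 t - wn k t) i; rewrite !mxE => /le_trans; apply.
    by apply: CP; rewrite le_max lexx.
  exists (\row_i l i), (2 * C) => k; apply: rV_norm_le => [|i].
    by rewrite divr_ge0 ?mulr_ge0 ?exprn_ge0.
  by rewrite !mxE.
have [w wP] := choice lim.
(* Uniqueness of the limit transfers to [w] the bounds of [step], uniform in [t <= T]. *)
have wunif (T : R) : 0 < T -> exists2 C, 0 <= C &
    forall k (t : R), t <= T -> `|w t - wn k t| <= C / 2 ^+ k.
  move=> T0; have [C C0 CP] := step T T0; exists (2 * C); first by rewrite mulr_ge0.
  move=> k t tT; apply: rV_norm_le => [|i].
    by rewrite divr_ge0 ?mulr_ge0 ?exprn_ge0.
  have [j|l lP] := @geometric_limit R (fun k => wn k t 0 i) C.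
    have := coord_le_norm (wn j.+1 t - wn j t) i; rewrite !mxE => /le_trans; apply.
    exact: CP.
  have [C' C'P] := wP t.
  rewrite !mxE; suff <- : l = w t 0 i by exact: lP.
  apply/eqP; rewrite -subr_eq0 -normr_le0.
  apply: (@le_geometric_le0 _ _ (2 * C + C')) => j.
  rewrite -(subrKA (wn j t 0 i)) mulrDl; apply: le_trans (ler_normD _ _) _.
  rewrite lerD// distrC.
  by have := coord_le_norm (w t - wn j t) i; rewrite !mxE => /le_trans; apply.
have wc : continuous w.
  move=> t; apply/cvgrPdist_le => e e0.
  have [C C0 CP] := wunif (Num.max (t + 1) 1) ltac:(by rewrite lt_max ltr01 orbT).
  have e3 : 0 < e / 3 by rewrite divr_gt0.
  have [k Ck] : exists k, C / 2 ^+ k <= e / 3.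
    apply: contrapT => /forallNP Ce; have := @le_geometric_le0 R (e / 3) C.
    suff /[swap]/[apply] : forall k, e / 3 <= C / 2 ^+ k by lra.
    by move=> k; have /negP := Ce k; rewrite -ltNge => /ltW.
  have tT : t <= Num.max (t + 1) 1 by rewrite le_max lerDl ler01.
  have := wnc k t => /cvgrPdist_le/(_ _ e3) => wk.
  near=> s.
  have sT : s <= Num.max (t + 1) 1.
    rewrite le_max; apply/orP; left; near: s; apply: lt_le_nbhsl.
    by rewrite ltrDl.
  have h1 := le_trans (CP k t tT) Ck; have h2 := le_trans (CP k s sT) Ck.
  have h3 : `|wn k t - wn k s| <= e / 3 by near: s.
  have -> : w t - w s = (w t - wn k t) + (wn k t - wn k s) - (w s - wn k s).
    by rewrite subrKA opprB addrA subrK.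
  apply: le_trans (ler_normB _ _) _; have := ler_normD (w t - wn k t) (wn k t - wn k s).
  lra.
have [Gc G0 Gd] := AP _ (X_cont wc).
(* Fixed point: [wn k.+1] is within [C / 2 ^+ k] of [w] and, integrating the Lipschitz bound, within
   [L * C * T / 2 ^+ k] of the antiderivative. *)
have wG : w = A (fun t => X t (w t)).
  apply/funext => t; set G := A _ in Gc G0 Gd *.
  have T0 : 0 < Num.max t 1 by rewrite lt_max ltr01 orbT.
  have tT : t <= Num.max t 1 by rewrite le_max lexx.
  set T := Num.max t 1 in T0 tT.
  have [C C0 CP] := wunif T T0; have [L L0 XL] := X_lip T0.
  apply/eqP; rewrite -subr_eq0 -normr_le0.
  apply: (@le_geometric_le0 _ _ (C + L * C * T)) => k.
  have twok : 0 < 2 ^+ k :> R by rewrite exprn_gt0.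
  rewrite -(subrKA (wn k.+1 t)) mulrDl; apply: le_trans (ler_normD _ _) _.
  apply: lerD.
    apply: le_trans (CP _ _ tT) _; rewrite ler_wpM2l// lef_pV2 ?posrE ?exprn_gt0//.
    by rewrite exprS; apply: ler_peMl; [exact: ltW|rewrite ler1n].
  have [t0|/ltW t0] := leP 0 t; last first.
    by rewrite wn0// G0// subrr normr0 divr_ge0 ?addr_ge0 ?mulr_ge0// ltW.
  apply: rV_norm_le => [|i].
    by rewrite divr_ge0 ?mulr_ge0 ?(ltW L0) ?(ltW T0) ?(ltW twok).
  pose f s := wn k.+1 s 0 i - G s 0 i; pose a := L * (C / 2 ^+ k).
  have f0 : f 0 = 0 by rewrite /f wn0// G0// subrr.
  have fa : `|f t - f 0| <= a * t - a * 0.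
    apply: (@mean_value_le R f (fun s => X s (wn k s) 0 i - X s (w s) 0 i)
      (fun s => a * s) (fun=> a) 0 t t0) => //.
    - by move=> s; apply: cvgB; [exact: (coordc _ _ (wnc k.+1))|exact: (coordc _ _ Gc)].
    - by move=> s; apply: cvgMr; exact: cvg_id.
    - move=> s /andP[s0 _]; apply: is_deriveB.
        by have /is_derive_rV := wnd k s s0; exact.
      by have /is_derive_rV := Gd s s0; exact.
    - move=> s _; have := is_deriveZ a (is_derive_id s (1 : R)).
      by rewrite /GRing.scale /= mulr1.
    - move=> s /andP[s0 st].
      have sT : s < T by exact: lt_le_trans tT.
      have := coord_le_norm (X s (wn k s) - X s (w s)) i.
      rewrite !mxE => /le_trans; apply.
      apply: le_trans (XL s _ _ _) _; first by rewrite s0.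
      by rewrite ler_pM2l// distrC; apply: CP; exact: ltW.
  rewrite [X in `|X|](_ : _ = f t - f 0); last by rewrite f0 subr0 !mxE.
  apply: le_trans fa _; rewrite mulr0 subr0.
  rewrite (_ : _ / _ = a * T) ?ler_wpM2l ?mulr_ge0 ?(ltW L0) ?divr_ge0 ?(ltW twok)//.
  by rewrite /a; ring.
exists w; split => //; first by rewrite wG G0.
by move=> t t0; rewrite {1}wG; exact: Gd.
Unshelve. all: by end_near.
Qed.

End Picard.

Lemma ler_norm_addB (R : numDomainType) (V : normedZmodType R) (x y : V) :
  `|x| <= `|y| + `|x - y|.
Proof. by have := ler_normD y (x - y); rewrite addrC subrK. Qed.

(** * Inner products, their continuity and derivatives *)

Section InnerProduct.
Variables (R : realType) (V : completeNormedModType R) (inner : V -> V -> R).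
Hypothesis innerC : forall x y, inner x y = inner y x.
Hypothesis inner_lin : forall a x y z,
  inner (a *: x + y) z = a * inner x z + inner y z.
Hypothesis inner_norm : forall x, inner x x = `|x| ^+ 2.

Lemma inner0l z : inner 0 z = 0.
Proof.
have := inner_lin 1 0 0 z; rewrite scale1r addr0 mul1r => /eqP.
by rewrite -subr_eq subrr eq_sym => /eqP.
Qed.

Lemma innerDl x y z : inner (x + y) z = inner x z + inner y z.
Proof. by rewrite -[x]scale1r inner_lin mul1r scale1r. Qed.

Lemma innerZl a x z : inner (a *: x) z = a * inner x z.
Proof. by rewrite -[a *: x]addr0 inner_lin inner0l addr0. Qed.

Lemma innerNl x z : inner (- x) z = - inner x z.
Proof. by rewrite -scaleN1r innerZl mulN1r. Qed.

Lemma innerBl x y z : inner (x - y) z = inner x z - inner y z.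
Proof. by rewrite innerDl innerNl. Qed.

Lemma innerDr x y z : inner z (x + y) = inner z x + inner z y.
Proof. by rewrite innerC innerDl !(innerC z). Qed.

Lemma innerZr a x z : inner z (a *: x) = a * inner z x.
Proof. by rewrite innerC innerZl innerC. Qed.

Lemma innerNr x z : inner z (- x) = - inner z x.
Proof. by rewrite innerC innerNl innerC. Qed.

Lemma innerBr x y z : inner z (x - y) = inner z x - inner z y.
Proof. by rewrite innerC innerBl !(innerC z). Qed.

(** Splits the difference of two gradients of the loss into a variation of the differential and a
    variation of the residual. *)
Lemma innerNB x y z w :
  - inner x z - - inner y w = inner y (w - z) - inner (x - y) z.
Proof. by rewrite innerBr innerBl; ring. Qed.

Lemma inner_sumr (I : Type) (r : seq I) (f : I -> V) z :
  inner z (\sum_(i <- r) f i) = \sum_(i <- r) inner z (f i).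
Proof.
elim: r => [|i r IH]; first by rewrite !big_nil innerC inner0l.
by rewrite !big_cons innerDr IH.
Qed.

(** Reduces the continuity of [inner] to that of the norm. *)
Lemma inner_polar x y : inner x y = 4^-1 * (`|x + y| ^+ 2 - `|x - y| ^+ 2).
Proof.
by rewrite -!inner_norm !(innerDl, innerDr, innerNl, innerNr) (innerC y x); field.
Qed.

Lemma cauchy_schwarz x y : `|inner x y| <= `|x| * `|y|.
Proof.
have [->|y0] := eqVneq y 0; first by rewrite innerC inner0l !normr0 mulr0.
have ny : 0 < `|y| ^+ 2 by rewrite exprn_gt0 ?normr_gt0.
rewrite -(@ler_pXn2r _ 2)// ?nnegrE ?mulr_ge0// real_normK ?num_real// exprMn.
have : 0 <= inner (`|y| ^+ 2 *: x - inner x y *: y) (`|y| ^+ 2 *: x - inner x y *: y).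
  by rewrite inner_norm sqr_ge0.
rewrite innerBl !innerBr !innerZl !innerZr !inner_norm (innerC y x).
set c := inner x y; set a := `|x| ^+ 2; set b := `|y| ^+ 2 in ny *.
have -> : b * (b * a) - b * (c * c) - (c * (b * c) - c * (c * b)) =
    b * (a * b - c ^+ 2) by ring.
by rewrite pmulr_rge0// subr_ge0.
Qed.

Lemma cvg_inner (T : Type) (F : set_system T) (FF : Filter F) (f : T -> V) l z :
  f t @[t --> F] --> l -> inner (f t) z @[t --> F] --> inner l z.
Proof.
move=> fl; rewrite inner_polar; under eq_fun do rewrite inner_polar.
apply: cvgMr; apply: cvgB.
  rewrite expr2; under eq_fun do rewrite expr2.
  by apply: cvgM; apply: cvg_norm; apply: cvgD => //; exact: cvg_cst.
rewrite expr2; under eq_fun do rewrite expr2.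
by apply: cvgM; apply: cvg_norm; apply: cvgB => //; exact: cvg_cst.
Qed.

Lemma is_derive_cvg (U Z : normedModType R) (a v : U) (y : U -> Z) (dy : Z) :
  h^-1 *: (y (h *: v + a) - y a) @[h --> 0^'] --> dy -> is_derive a v y dy.
Proof. by move=> yd; apply: DeriveDef; [exact: cvgP yd|exact: cvg_lim yd]. Qed.

Lemma cvg_is_derive (U Z : normedModType R) (a v : U) (y : U -> Z) (dy : Z) :
  is_derive a v y dy -> h^-1 *: (y (h *: v + a) - y a) @[h --> 0^'] --> dy.
Proof. by case=> yd <-. Qed.

Lemma is_derive_inner (U : normedModType R) (a v : U) (y : U -> V) dy z :
  is_derive a v y dy -> is_derive a v (fun x => inner (y x) z) (inner dy z).
Proof.
move=> /cvg_is_derive yd; apply: is_derive_cvg.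
under eq_fun do rewrite -innerBl /GRing.scale /= -innerZl.
exact: cvg_inner yd.
Qed.

(** With [D h] the difference quotient of [y], that of the half square is [inner (D h) (y a)] plus
    [h / 2] times the square of the norm of [D h], which tends to 0. *)
Lemma is_derive_half_sqnorm (U : normedModType R) (a v : U) (y : U -> V) dy :
  is_derive a v y dy ->
  is_derive a v (fun x => 2^-1 * `|y x| ^+ 2) (inner dy (y a)).
Proof.
move=> /cvg_is_derive; set D := fun h : R => h^-1 *: (y (h *: v + a) - y a) => yd.
apply: is_derive_cvg.
have DE : \forall h \near 0^', inner (D h) (y a) + 2^-1 * (h * (`|D h| * `|D h|)) =
    h^-1 *: (2^-1 * `|y (h *: v + a)| ^+ 2 - 2^-1 * `|y a| ^+ 2).
  near=> h; have h0 : h != 0 by near: h; exact: nbhs_dnbhs_neq.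
  have -> : y (h *: v + a) = y a + h *: D h.
    by rewrite /D scalerA mulfV// scale1r [RHS]addrC subrK.
  rewrite -expr2 -!inner_norm innerDl !innerDr !innerZl !innerZr (innerC (y a)).
  by rewrite /GRing.scale /=; field.
have DL : inner (D h) (y a) + 2^-1 * (h * (`|D h| * `|D h|)) @[h --> 0^'] -->
    inner dy (y a) + 2^-1 * (0 * (`|dy| * `|dy|)).
  apply: cvgD; first exact: cvg_inner yd.
  apply: cvgMr; apply: cvgM; first exact: cvg_within.
  by apply: cvgM; exact: cvg_norm yd.
rewrite mul0r mulr0 addr0 in DL.
exact: cvg_trans (near_eq_cvg DE) DL.
Unshelve. all: by end_near.
Qed.

End InnerProduct.

(** * The loss, its gradient and Lipschitz bounds *)

Section Loss.
Variables (R : realType) (W : nat) (V : completeNormedModType R).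
Variable inner : V -> V -> R.
Hypothesis innerC : forall x y, inner x y = inner y x.
Hypothesis inner_lin : forall a x y z,
  inner (a *: x + y) z = a * inner x z + inner y z.
Hypothesis inner_norm : forall x, inner x x = `|x| ^+ 2.
Local Notation E := 'rV[R]_W.
Variable Phi : E -> V.
Hypothesis Phi_diff : forall w, differentiable Phi w.
Variable k : R.
Hypothesis Phi_lip : forall w1 w2 v : E,
  `|'d Phi w1 v - 'd Phi w2 v| <= k * `|w1 - w2| * `|v|.

Lemma is_derive_loss (U : normedModType R) (a v : U) (w : U -> E) f dw :
  is_derive a v (Phi \o w) dw ->
  is_derive a v (fun x => loss Phi f (w x)) (- inner (f - Phi (w a)) dw).
Proof.
move=> Pd; rewrite -(innerC dw) -(innerNl inner_lin).
apply: (is_derive_half_sqnorm innerC inner_lin inner_norm).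
by rewrite -[- dw]add0r; apply: is_deriveB.
Qed.

Lemma grad_lossE f w i :
  grad (loss Phi f) w 0 i = - inner (f - Phi w) ('d Phi w (delta_mx 0 i)).
Proof.
rewrite mxE; apply: (@derive_val _ _ _ _ _ _ _ (is_derive_loss (w := id) f _)).
by rewrite -deriveE//; apply: derivableP; exact: diff_derivable.
Qed.

Lemma is_derive_Phi (w : R -> E) (t : R) (dw : E) :
  is_derive t 1 w dw -> is_derive t 1 (Phi \o w) ('d Phi (w t) dw).
Proof.
move=> [wd <-]; have wdf : differentiable w t by exact/derivable1_diffP.
have Pw : differentiable (Phi \o w) t by exact: differentiable_comp.
apply: DeriveDef; first exact/derivable1_diffP.
by rewrite !deriveE// diff_comp.
Qed.

Lemma is_derive_loss_curve (w : R -> E) f (t : R) (dw : E) : is_derive t 1 w dw ->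
  is_derive t 1 (fun s => loss Phi f (w s))
    (\sum_i dw 0 i * grad (loss Phi f) (w t) 0 i).
Proof.
move=> wd.
rewrite (_ : \sum_i _ = - inner (f - Phi (w t)) ('d Phi (w t) dw)).
  exact: is_derive_loss (is_derive_Phi wd).
under eq_bigr do rewrite grad_lossE mulrN -(innerZr innerC inner_lin).
rewrite sumrN -(inner_sumr innerC inner_lin); congr (- inner _ _).
rewrite [in RHS](row_sum_delta dw) linear_sum; apply: eq_bigr => i _.
by rewrite linearZ.
Qed.

Local Notation k' := `|k|.

(** At 0 the differential is controlled by its values on the basis vectors; the Lipschitz bound
    carries this to [u]. *)
Lemma diff_Phi_bound : exists2 D, 0 <= D &
  forall u v : E, `|'d Phi u v| <= (D + k' * `|u|) * `|v|.
Proof.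
exists (\sum_i `|'d Phi 0 (delta_mx 0 i)|); first exact: sumr_ge0.
move=> u v; apply: le_trans (ler_norm_addB _ ('d Phi 0 v)) _.
rewrite mulrDl; apply: lerD.
  rewrite {1}(row_sum_delta v) linear_sum mulr_suml.
  apply: le_trans (ler_norm_sum _ _ _) _; apply: ler_sum => i _.
  by rewrite linearZ normrZ mulrC ler_wpM2l// coord_le_norm.
apply: le_trans (Phi_lip u 0 v) _; rewrite subr0 !ler_wpM2r//; exact: ler_norm.
Qed.

(** A mean value inequality for values in [V]: the scalar function [inner (Phi (w s)) z] is followed
    along the segment from [v] to [u], with [z] the total increment, and Cauchy-Schwarz allows
    division by the norm of [z]. *)
Lemma Phi_lipschitz_ball (B : R) : 0 <= B -> exists2 A, 0 <= A &
  (forall u v : E, `|u| <= B -> `|'d Phi u v| <= A * `|v|) /\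
  (forall u v : E, `|u| <= B -> `|v| <= B -> `|Phi u - Phi v| <= A * `|u - v|).
Proof.
move=> B0; have [D D0 DP] := diff_Phi_bound.
have A0 : 0 <= D + k' * B by rewrite addr_ge0// mulr_ge0.
have AP (u v : E) : `|u| <= B -> `|'d Phi u v| <= (D + k' * B) * `|v|.
  move=> uB; apply: le_trans (DP u v) _; rewrite ler_wpM2r// lerD2l.
  by rewrite ler_wpM2l.
exists (D + k' * B) => //; split => // u v uB vB.
set A := _ + _ in A0 AP *; set z := Phi u - Phi v.
have [->|z0] := eqVneq z 0; first by rewrite normr0 mulr_ge0.
have z1 : 0 < `|z| by rewrite normr_gt0.
pose w (s : R) : E := s *: (u - v) + v.
have wd (s : R) : is_derive s 1 w (u - v).
  rewrite -[u - v]addr0; apply: is_deriveD.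
  apply/is_derive_rV => i; under eq_fun do rewrite mxE mulrC.
  have := is_deriveZ ((u - v) 0 i) (is_derive_id s (1 : R)).
  by rewrite /GRing.scale /= mulr1.
have Pd (s : R) : is_derive s 1 (fun s => inner (Phi (w s)) z)
    (inner ('d Phi (w s) (u - v)) z).
  exact: (is_derive_inner innerC inner_lin inner_norm z (is_derive_Phi (wd s))).
have := @mean_value_le R (fun s => inner (Phi (w s)) z)
  (fun s => inner ('d Phi (w s) (u - v)) z)
  (fun s => A * `|u - v| * `|z| * s) (fun=> A * `|u - v| * `|z|) 0 1 ler01.
have w1 : w 1 = u by rewrite /w scale1r subrK.
have w0 : w 0 = v by rewrite /w scale0r add0r.
rewrite /= w1 w0 mulr1 mulr0 subr0.
rewrite -(innerBl inner_lin) -/z inner_norm ger0_norm ?sqr_ge0//.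
rewrite expr2 ler_pM2r//; apply.
- by move=> s; apply/differentiable_continuous/derivable1_diffP; case: (Pd s).
- by move=> s; apply: cvgMr; exact: cvg_id.
- move=> s _; have := is_deriveZ (A * `|u - v| * `|z|) (is_derive_id s (1 : R)).
  by rewrite /GRing.scale /= mulr1.
- move=> s /andP[s0 s1]; apply: le_trans (cauchy_schwarz innerC inner_lin inner_norm _ _) _.
  rewrite ler_wpM2r//; apply: AP.
  rewrite (_ : w s = s *: u + (1 - s) *: v); last first.
    by rewrite /w scalerBr scalerBl scale1r addrA addrAC.
  apply: le_trans (ler_normD _ _) _; rewrite !normrZ (gtr0_norm s0).
  rewrite gtr0_norm ?subr_gt0//.
  have : s * `|u| <= s * B by rewrite ler_pM2l.
  have : (1 - s) * `|v| <= (1 - s) * B by rewrite ler_pM2l// subr_gt0.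
  lra.
Qed.

(** With [f = f'] it gives existence of the flow; with [f] and [f'] distinct, its continuous
    dependence on the target. *)
Lemma grad_loss_lipschitz (B M : R) : 0 <= B -> 0 <= M -> exists2 K, 0 <= K &
  forall f f' u v, `|f| <= M -> `|f'| <= M -> `|u| <= B -> `|v| <= B ->
  `|grad (loss Phi f) u - grad (loss Phi f') v| <= K * (`|u - v| + `|f - f'|).
Proof.
move=> B0 M0; have [A A0 [dA PA]] := Phi_lipschitz_ball B0.
(* [P] bounds the residual [f' - Phi v]. *)
pose P := M + `|Phi 0| + A * B.
have P0 : 0 <= P by rewrite !addr_ge0// mulr_ge0.
exists (A * A + A + P * k'); first by rewrite !addr_ge0// mulr_ge0.
move=> f f' u v fM f'M uB vB; apply: rV_norm_le => [|i].
  by rewrite mulr_ge0 ?addr_ge0// mulr_ge0.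
have e1 : `|delta_mx 0 i : E| <= 1.
  apply: rV_norm_le => // j; rewrite mxE eqxx /=.
  by case: (_ == _); rewrite ?normr1 ?normr0.
set e := delta_mx 0 i in e1.
rewrite [X in `|X|](_ : _ = grad (loss Phi f) u 0 i -
  grad (loss Phi f') v 0 i); last by rewrite !mxE.
rewrite !grad_lossE -/e.
rewrite (innerNB innerC inner_lin) (_ : f - Phi u - (f' - Phi v) =
  f - f' - (Phi u - Phi v)); last first.
  by rewrite !opprB [LHS]addrACA [RHS]addrACA (addrC (- Phi u)).
have CS := cauchy_schwarz innerC inner_lin inner_norm.
apply: le_trans (ler_normB _ _) _.
have h1 : `|inner (f' - Phi v) ('d Phi v e - 'd Phi u e)| <= P * (k' * `|u - v|).
  apply: le_trans (CS _ _) _; apply: ler_pM => //.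
    apply: le_trans (ler_normB _ _) _; rewrite /P -addrA lerD//.
    apply: le_trans (ler_norm_addB _ (Phi 0)) _.
    rewrite lerD2l; apply: le_trans (PA v 0 vB _) _; first by rewrite normr0.
    by rewrite subr0 ler_wpM2l.
  apply: le_trans (Phi_lip v u e) _; rewrite distrC.
  apply: (@le_trans _ _ (k' * `|u - v| * `|e|)).
    by rewrite !ler_wpM2r//; exact: ler_norm.
  by rewrite ler_piMr// mulr_ge0.
have h2 : `|inner (f - f' - (Phi u - Phi v)) ('d Phi u e)| <=
    (`|f - f'| + A * `|u - v|) * A.
  apply: le_trans (CS _ _) _; apply: ler_pM => //.
    by apply: le_trans (ler_normB _ _) _; rewrite lerD2l PA.
  by apply: le_trans (dA _ _ uB) _; rewrite ler_piMr.
apply: le_trans (lerD h1 h2) _.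
have -> : (A * A + A + P * k') * (`|u - v| + `|f - f'|) =
  P * (k' * `|u - v|) + (`|f - f'| + A * `|u - v|) * A +
  (A * A * `|f - f'| + A * `|u - v| + P * k' * `|f - f'|) by ring.
by rewrite lerDl !addr_ge0 ?mulr_ge0.
Qed.

End Loss.

(** * The squared Euclidean norm and a Gronwall inequality *)

Section EuclideanSquare.
Variables (R : realType) (n : nat).
Local Notation E := 'rV[R]_n.

(** Row vectors carry the sup norm, which is not differentiable in general; the squared Euclidean
    norm replaces it in differential inequalities. *)
Definition sqsum (u : E) : R := \sum_i u 0 i * u 0 i.

Lemma sqr_norm_le_sqsum (u : E) : `|u| ^+ 2 <= sqsum u.
Proof.
have s0 : 0 <= sqsum u by apply: sumr_ge0 => i _; rewrite -expr2 sqr_ge0.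
rewrite -(sqr_sqrtr s0) ler_pXn2r ?nnegrE ?sqrtr_ge0//.
apply: rV_norm_le => [|i]; first exact: sqrtr_ge0.
rewrite -[leLHS]sqrtr_sqr ler_wsqrtr// /sqsum (bigD1 i)//= -expr2 lerDl.
by apply: sumr_ge0 => j _; rewrite -expr2 sqr_ge0.
Qed.

Lemma sqsum_continuous (w : R -> E) : continuous w ->
  continuous (fun t => sqsum (w t)).
Proof.
move=> wc t; apply: (@cvg_sumr _ _ _ (nbhs t) _ _ _ (fun i s => w s 0 i * w s 0 i)).
by move=> i; apply: cvgM; apply: cvg_coord; exact: wc.
Qed.

Lemma is_derive_sumr (t : R) (h : 'I_n -> R -> R) (dh : 'I_n -> R) :
  (forall i, is_derive t 1 (h i) (dh i)) ->
  is_derive t 1 (fun s => \sum_i h i s) (\sum_i dh i).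
Proof.
move=> hd; rewrite (_ : (fun s => _) = \sum_i h i); first exact: is_derive_sum.
by apply/funext => s; rewrite fct_sumE.
Qed.

Lemma is_derive_sqsum (w : R -> E) (t : R) (dw : E) : is_derive t 1 w dw ->
  is_derive t 1 (fun s => sqsum (w s)) (\sum_i 2 * (w t 0 i * dw 0 i)).
Proof.
move=> /is_derive_rV wd; apply: is_derive_sumr => i.
have := is_deriveM (wd i) (wd i); rewrite /GRing.scale /= => H.
by apply: is_derive_eq H _; ring.
Qed.

Lemma is_derive_expR_lin (a t : R) :
  is_derive t 1 (fun s => expR (a * s)) (a * expR (a * t)).
Proof.
have h : is_derive t 1 (fun s => a * s) a.
  by have := is_deriveZ a (is_derive_id t (1 : R)); rewrite /GRing.scale /= mulr1.
by have := is_derive1_comp (is_derive_expR _) h; rewrite mulrC.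
Qed.

Lemma continuous_expR_lin (a : R) : continuous (fun s => expR (a * s)).
Proof.
by move=> t; apply/differentiable_continuous/derivable1_diffP;
  have [] := is_derive_expR_lin a t.
Qed.

(** For [h = sqsum (w1 - w2)], bounding [2 x y] by [x^2 + y^2] in each coordinate gives
    [h' <= a h + b d^2], so [b d^2 t - expR (- a t) h] is nondecreasing. *)
Lemma gronwall_curves (K T : R) : 0 <= K -> 0 <= T -> exists2 C, 0 <= C &
  forall (w1 w2 g1 g2 : R -> E) (d : R), 0 <= d -> continuous w1 -> continuous w2 ->
    w1 0 = w2 0 ->
    (forall t : R, 0 < t -> is_derive t 1 w1 (g1 t)) ->
    (forall t : R, 0 < t -> is_derive t 1 w2 (g2 t)) ->
    (forall t : R, 0 < t < T -> `|g1 t - g2 t| <= K * (`|w1 t - w2 t| + d)) ->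
  `|w1 T - w2 T| <= C * d.
Proof.
move=> K0 T0; pose b := 2 * n%:R * K ^+ 2; pose a := 1 + b.
have b0 : 0 <= b by rewrite !mulr_ge0 ?sqr_ge0.
pose c := expR (a * T) * b * T.
have c0 : 0 <= c by rewrite !mulr_ge0 ?expR_ge0.
(* As [c <= (1 + c)^2], the constant [1 + c] avoids a square root. *)
exists (1 + c); first by rewrite addr_ge0.
move=> w1 w2 g1 g2 d d0 w1c w2c w12 w1d w2d g12.
pose v t := w1 t - w2 t; pose h t := sqsum (v t); pose dv t := g1 t - g2 t.
have vc : continuous v by move=> t; apply: cvgB; [exact: w1c|exact: w2c].
have vd (t : R) : 0 < t -> is_derive t 1 v (dv t).
  by move=> t0; apply: is_deriveB; [exact: w1d|exact: w2d].
have hT : h T <= c * d ^+ 2.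
  pose H t := b * d ^+ 2 * t - expR (- a * t) * h t.
  have : H 0 <= H T.
    apply: (@derive_ge0_le R H (fun t => b * d ^+ 2 -
      (- a * expR (- a * t) * h t +
       expR (- a * t) * \sum_i 2 * (v t 0 i * dv t 0 i))) 0 T T0).
    - move=> t; apply: cvgB; first by apply: cvgMr; exact: cvg_id.
      by apply: cvgM; [exact: continuous_expR_lin|exact: sqsum_continuous].
    - move=> t /andP[t0 _]; apply: is_deriveB.
        have := is_deriveZ (b * d ^+ 2) (is_derive_id t (1 : R)).
        by rewrite /GRing.scale /= mulr1.
      have := is_deriveM (is_derive_expR_lin (- a) t) (is_derive_sqsum (vd t t0)).
      rewrite /GRing.scale /= => Hd; apply: is_derive_eq Hd _; rewrite /h; ring.
    - move=> t /andP[t0 tT].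
      have dvt : \sum_i 2 * (v t 0 i * dv t 0 i) <= a * h t + b * d ^+ 2.
        have hv : `|v t| ^+ 2 <= h t := sqr_norm_le_sqsum _.
        have dvb i : dv t 0 i ^+ 2 <= 2 * K ^+ 2 * (h t + d ^+ 2).
          have t0T : 0 < t < T by rewrite t0.
          have dvi : `|dv t 0 i| <= K * (`|v t| + d).
            exact: le_trans (coord_le_norm (dv t) i) (g12 t t0T).
          have := ler_pM (normr_ge0 _) (normr_ge0 _) dvi dvi.
          rewrite -normrM -expr2 ger0_norm ?sqr_ge0// => /le_trans; apply.
          rewrite -/(v t); have := sqr_ge0 (`|v t| - d); have := sqr_ge0 K.
          set N := `|v t| in hv *; set x := h t in hv *; nra.
        have : \sum_i 2 * (v t 0 i * dv t 0 i) <=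
            \sum_(i < n) (v t 0 i * v t 0 i + 2 * K ^+ 2 * (h t + d ^+ 2)).
          apply: ler_sum => i _; have := dvb i; have := sqr_ge0 (v t 0 i - dv t 0 i).
          set x := v t 0 i; set y := dv t 0 i; nra.
        move=> /le_trans; apply; rewrite big_split /= sumr_const card_ord.
        rewrite -/(sqsum (v t)) -/(h t) -mulr_natl /a /b le_eqVlt; apply/orP; left.
        by apply/eqP; ring.
      have e0 : 0 <= expR (- a * t) by exact: expR_ge0.
      have e1 : expR (- a * t) <= 1.
        by rewrite -[leRHS]expR0 ler_expR mulNr oppr_le0 mulr_ge0 ?(ltW t0)// addr_ge0.
      have bd0 : 0 <= b * d ^+ 2 by rewrite mulr_ge0 ?sqr_ge0.
      have := ler_wpM2l e0 dvt; have := ler_wpM2r bd0 e1; rewrite mul1r.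
      set e := expR _; set S := \sum_i _; set D := b * _; set x := h t.
      by rewrite mulrDr !mulrA; lra.
  rewrite /H mulr0 {1}/h /v w12 subrr (_ : sqsum 0 = 0); last first.
    by apply: big1 => i _; rewrite mxE mul0r.
  rewrite mulr0 subrr subr_ge0 mulNr expRN ler_pdivrMl ?expR_gt0// => /le_trans.
  apply; rewrite /c le_eqVlt; apply/orP; left; apply/eqP; ring.
rewrite -(@ler_pXn2r _ 2)// ?nnegrE ?mulr_ge0// ?addr_ge0//.
apply: le_trans (sqr_norm_le_sqsum _) _; apply: le_trans hT _.
rewrite exprMn ler_wpM2r ?sqr_ge0//; nra.
Qed.

End EuclideanSquare.

(** * Gradient flows of nonnegative functions *)

Section GradientFlow.
Variables (R : realType) (n : nat).
Local Notation E := 'rV[R]_n.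
Variables (L : E -> R) (gr : E -> E).
Hypothesis L_ge0 : forall u, 0 <= L u.
Hypothesis L_cont : continuous L.
Hypothesis L_chain : forall (w : R -> E) (t : R) dw, is_derive t 1 w dw ->
  is_derive t 1 (fun s => L (w s)) (\sum_i dw 0 i * gr (w t) 0 i).
Hypothesis gr_lip : forall B : R, 0 <= B -> exists2 K, 0 <= K &
  forall u v, `|u| <= B -> `|v| <= B -> `|gr u - gr v| <= K * `|u - v|.

Lemma L_curve_continuous (w : R -> E) : continuous w ->
  continuous (fun t => L (w t)).
Proof. by move=> wc t P /L_cont/wc. Qed.

(* q = |w|^2 / 2 + L(w) satisfies q' <= q along any flow slowed down by a factor
   chi in [0, 1]. *)
Lemma damped_flow_bound (w : R -> E) (chi : R -> R) :
  continuous w -> w 0 = 0 -> (forall t, 0 <= chi t <= 1) ->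
  (forall t : R, 0 < t -> is_derive t 1 w (- (chi t *: gr (w t)))) ->
  forall t, 0 <= t -> sqsum (w t) <= 2 * expR t * L 0.
Proof.
move=> wc w0 chi01 wd T T0.
pose q t := 2^-1 * sqsum (w t) + L (w t).
pose dq t := - (chi t *: gr (w t)).
pose H t := - (expR (- 1 * t) * q t).
have qc : continuous q.
  move=> t; apply: cvgD; last exact: L_curve_continuous.
  by apply: cvgMr; exact: sqsum_continuous.
have : H 0 <= H T.
  apply: (@derive_ge0_le R H (fun t => - (-1 * expR (- 1 * t) * q t +
     expR (-1 * t) * (2^-1 * (\sum_i 2 * (w t 0 i * dq t 0 i)) +
       \sum_i dq t 0 i * gr (w t) 0 i))) 0 T T0).
  - move=> t; apply: cvgN; apply: cvgM; last exact: qc.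
    exact: continuous_expR_lin.
  - move=> t /andP[t0 _]; apply: is_deriveN.
    have qd : is_derive t 1 q (2^-1 * (\sum_i 2 * (w t 0 i * dq t 0 i)) +
        \sum_i dq t 0 i * gr (w t) 0 i).
      exact: is_deriveD (is_deriveZ 2^-1 (is_derive_sqsum (wd t t0)))
      (L_chain (wd t t0)).
    have := is_deriveM (is_derive_expR_lin (- 1) t) qd.
    rewrite /GRing.scale /= => Hd; apply: is_derive_eq Hd _.
    by ring.
  - move=> t /andP[t0 _]; set S := 2^-1 * (\sum_i _) + _.
    rewrite (_ : - _ = expR (- 1 * t) * (q t - S)); last by ring.
    apply: mulr_ge0; first exact: expR_ge0.
    rewrite (_ : q t - S = L (w t) + \sum_i (2^-1 * (w t 0 i * w t 0 i) -
        2^-1 * (2 * (w t 0 i * dq t 0 i)) - dq t 0 i * gr (w t) 0 i)); last first.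
      by rewrite !sumrB /q /S /sqsum -!mulr_sumr; ring.
    apply: addr_ge0 => //; apply: sumr_ge0 => i _; rewrite /dq !mxE.
    have /andP[] := chi01 t; set x := w t 0 i; set y := gr _ 0 i; set c := chi t.
    move=> c0 c1.
    (* Completing squares: apart from [L], each coordinate of [q - q'] is a convex combination of
       two nonnegative terms, with weights [c] and [1 - c]. *)
    rewrite (_ : _ - _ = c * (2^-1 * ((x + y) ^+ 2 + y ^+ 2)) +
      (1 - c) * (2^-1 * x ^+ 2)); last by field.
    by rewrite addr_ge0// mulr_ge0 ?subr_ge0// mulr_ge0 ?addr_ge0 ?sqr_ge0.
rewrite /H mulr0 expR0 mul1r lerN2 /q w0 (_ : sqsum 0 = 0); last first.
  by apply: big1 => i _; rewrite mxE mul0r.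
rewrite mulr0 add0r mulN1r expRN ler_pdivrMl ?expR_gt0//.
have := L_ge0 (w T); lra.
Qed.

Lemma flow_nonincreasing (w : R -> E) : continuous w ->
  (forall t : R, 0 < t -> is_derive t 1 w (- gr (w t))) ->
  forall s t, 0 <= s <= t -> L (w t) <= L (w s).
Proof.
move=> wc wd s t /andP[s0 st]; rewrite -lerN2.
apply: (@derive_ge0_le R (fun r => - L (w r))
  (fun r => - \sum_i (- gr (w r)) 0 i * gr (w r) 0 i) s t st).
- by move=> r; apply: cvgN; exact: L_curve_continuous.
- move=> r /andP[sr _]; apply: is_deriveN; apply: L_chain; apply: wd.
  exact: le_lt_trans sr.
- move=> r _; rewrite -sumrN; apply: sumr_ge0 => i _.
  by rewrite mxE mulNr opprK -expr2 sqr_ge0.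
Qed.

Lemma gr_continuous : continuous gr.
Proof.
suff gc (u : E) : gr v @[v --> u] --> gr u by move=> u; exact: gc.
have [K K0 KP] := gr_lip (ltac:(by []) : 0 <= `|u| + 1).
apply/(@cvgrPdist_le R E E (nbhs u) _ gr (gr u)) => e e0.
have ue : 0 < e / (K + 1) by rewrite divr_gt0// ltr_wpDl.
have Fu : Filter (nbhs u) by exact: nbhs_filter.
have idc : id v @[v --> u] --> u by exact: cvg_id.
have h1 : \forall v \near u, `|u - v| <= 1 :=
  @cvgr_dist_le _ _ _ _ Fu _ _ idc _ ltr01.
have h2 : \forall v \near u, `|u - v| <= e / (K + 1) :=
  @cvgr_dist_le _ _ _ _ Fu _ _ idc _ ue.
have imp v : `|u - v| <= 1 -> `|u - v| <= e / (K + 1) -> `|gr u - gr v| <= e; last first.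
  exact: (filterS2 _ imp h1 h2).
move=> uv1.
rewrite ler_pdivlMr ?ltr_wpDl// mulrDr mulr1 mulrC => h.
apply: le_trans (KP u v _ _) _; first by rewrite lerDl.
  by apply: le_trans (ler_norm_addB v u) _; rewrite lerD2l distrC.
by apply: le_trans h; rewrite lerDl.
Qed.

Definition cutoff (s : R) : R := Num.max 0 (1 - Num.max 0 s).

Lemma cutoff01 s : 0 <= cutoff s <= 1.
Proof.
rewrite /cutoff le_max lexx /= ge_max ler01 /= gerBl.
by rewrite le_max lexx.
Qed.

Lemma cutoff_eq1 s : s <= 0 -> cutoff s = 1.
Proof. by move=> s0; rewrite /cutoff (max_l s0) subr0 max_r. Qed.

Lemma cutoff_eq0 s : 1 <= s -> cutoff s = 0.
Proof.
move=> s1; rewrite /cutoff (max_r (le_trans ler01 s1)) max_l//.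
by rewrite subr_le0.
Qed.

Lemma cutoff_lip s t : `|cutoff s - cutoff t| <= `|s - t|.
Proof.
have m0 a b : `|Num.max 0 a - Num.max 0 b| <= `|a - b| :> R.
  have := lexx `|a - b|; rewrite {1}ler_norml => /andP[h1 h2].
  by rewrite /Num.max; case: ltrP => ha; case: ltrP => hb;
    rewrite ler_norml; apply/andP; split; lra.
apply: le_trans (m0 _ _) _; rewrite (_ : 1 - _ - (1 - _) = Num.max 0 t - Num.max 0 s); last by ring.
by rewrite distrC; exact: m0.
Qed.

Lemma cvg_cutoff (T : Type) (F : set_system T) (FF : Filter F) (f : T -> R) l :
  f t @[t --> F] --> l -> cutoff (f t) @[t --> F] --> cutoff l.
Proof.
move=> fl; apply: cvg_maxr; first exact: cvg_cst.
apply: cvgB; first exact: cvg_cst.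
by apply: cvg_maxr => //; exact: cvg_cst.
Qed.

(* Cutting the field off beyond radius beta t makes it globally Lipschitz, and by
   damped_flow_bound the trajectory from 0 never reaches the cut-off region. *)
Let beta t := 1 + 2 * expR (1 * t) * L 0.

Lemma gradient_flow_exists : exists w : R -> E, [/\ w 0 = 0, continuous w,
  forall t : R, 0 < t -> is_derive t 1 w (- gr (w t)) &
  forall t, 0 <= t -> `|w t| <= 1 + 2 * expR t * L 0].
Proof.
pose X (t : R) (u : E) := - (cutoff (`|u| - beta t) *: gr u).
have beta0 t : 0 <= beta t.
  by rewrite addr_ge0// !mulr_ge0// expR_ge0.
have betac : continuous beta.
  move=> t; apply: cvgD; first exact: cvg_cst.
  apply: cvgMl; apply: cvgMr; exact: continuous_expR_lin.
have [||w [w0 wc wd]] := @picard_global R n X.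
- move=> w wc t; apply: cvgN; apply: cvgZ.
    apply: cvg_cutoff; apply: cvgB; last exact: betac.
    by apply: cvg_norm; exact: wc.
  by move=> P /gr_continuous/wc.
(* Up to time [T] the cut-off field vanishes outside radius [B], so a Lipschitz constant of [gr] on
   that ball suffices; by symmetry one of the two points may be taken inside it. *)
- move=> T T0; pose B := beta T + 1.
  have B0 : 0 <= B by rewrite addr_ge0.
  have [K K0 KP] := gr_lip B0.
  pose M := `|gr 0| + K * B.
  have M0 : 0 <= M by rewrite addr_ge0// mulr_ge0.
  have grM u : `|u| <= B -> `|gr u| <= M.
    move=> uB; apply: le_trans (ler_norm_addB _ (gr 0)) _; rewrite lerD2l.
    by apply: le_trans (KP _ _ uB _) _; rewrite ?normr0// subr0 ler_wpM2l.
  exists (M + K + 1); first by apply: ltr_wpDl => //; exact: addr_ge0.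
  move=> t u v /andP[t0 tT].
  have bT : beta t <= beta T.
    by rewrite lerD2l ler_wpM2r// ler_pM2l// ler_expR !mul1r ltW.
  have c0 x : B < `|x| -> cutoff (`|x| - beta t) = 0.
    by move=> Bx; apply: cutoff_eq0; move: Bx; rewrite /B; lra.
  suff main x y : `|x| <= B -> `|X t x - X t y| <= (M + K + 1) * `|x - y|.
    have [uB|Bu] := leP `|u| B; first exact: main.
    have [vB|Bv] := leP `|v| B; first by rewrite distrC (distrC u); exact: main.
    rewrite /X !c0// !scale0r subrr normr0 mulr_ge0// addr_ge0//; exact: addr_ge0.
  move=> xB; rewrite /X -opprD normrN.
  set cx := cutoff _; set cy := cutoff _.
  have cxy : `|cx - cy| <= `|x - y|.
    apply: le_trans (cutoff_lip _ _) _.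
    rewrite opprB addrA subrK; exact: ler_dist_dist.
  have e : cx *: gr x - cy *: gr y = (cx - cy) *: gr x + cy *: (gr x - gr y).
    by rewrite scalerBl scalerBr addrA subrK.
  rewrite e; apply: le_trans (ler_normD _ _) _; rewrite !normrZ.
  have h1 : `|cx - cy| * `|gr x| <= M * `|x - y|.
    by rewrite mulrC; apply: ler_pM => //; exact: grM.
  have h2 : `|cy| * `|gr x - gr y| <= K * `|x - y|.
    have [yB|By] := leP `|y| B; last first.
      by rewrite /cy c0// normr0 mul0r mulr_ge0.
    have /andP[cy0 cy1] := cutoff01 (`|y| - beta t).
    rewrite ger0_norm//; apply: le_trans (KP x y xB yB).
    by rewrite ler_piMl.
  apply: le_trans (lerD h1 h2) _; rewrite -mulrDl ler_wpM2r// lerDl//.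
(* With [z = 2 * expR t * L 0], the square of the norm is at most [z], hence at most [(1 + z)^2],
   which is the square of [beta t]. *)
have wb t : 0 <= t -> `|w t| <= beta t.
  move=> t0; have := @damped_flow_bound w (fun t => cutoff (`|w t| - beta t))
    wc w0 (fun t => cutoff01 _) wd t t0.
  move=> /(le_trans (sqr_norm_le_sqsum _)) => h.
  rewrite -(@ler_pXn2r _ 2)// ?nnegrE//; apply: le_trans h _; rewrite /beta mul1r.
  have : 0 <= 2 * expR t * L 0 by rewrite !mulr_ge0// expR_ge0.
  set z := _ * _; nra.
exists w; split => //; last by move=> t /wb; rewrite /beta mul1r.
move=> t t0; have := wd t t0; rewrite /X cutoff_eq1 ?scale1r//.
by rewrite subr_le0 wb// ltW.
Qed.

End GradientFlow.

(** * The Euclidean sphere and its antipodal points *)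

Section Sphere.
Variables (R : realType) (n : nat).
Local Notation E := 'rV[R]_n.+1.

Lemma sphere_compact : compact (sphere R n).
Proof.
apply: bounded_closed_compact.
  exists 1; split => // M M1 x xS; apply: le_trans (ltW M1).
  rewrite -(@ler_pXn2r _ 2)// ?nnegrE// expr1n.
  apply: le_trans (sqr_norm_le_sqsum x) _.
  suff -> : sqsum x = 1 by [].
  by rewrite -[RHS]xS; apply: eq_bigr => i _; rewrite expr2.
apply: (@preimage_closed _ _ (fun x : E => \sum_i x 0 i ^+ 2) [set x | x = 1]).
  move=> x _; apply: (@cvg_sumr _ _ _ (nbhs x) _ _ _ (fun i (x : E) => x 0 i ^+ 2)).
  move=> i; rewrite expr2; under eq_fun do rewrite expr2.
  by apply: cvgM; exact: coord_continuous.
exact: closed_eq.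
Qed.

Lemma sphere_opp_neq (x : E) : sphere R n x -> x != - x.
Proof.
move=> xS; apply/eqP => /rowP xN; have : (1 : R) = 0 by rewrite -xS big1// => i _;
  move/eqP: (xN i); rewrite mxE -addr_eq0 -mulr2n mulrn_eq0/= => /eqP->; rewrite expr0n.
by move/eqP; rewrite oner_eq0.
Qed.

Lemma sphere_nonempty : sphere R n !=set0.
Proof.
exists (delta_mx 0 0); rewrite /sphere /= (bigD1 ord0)//= mxE eqxx big1 ?addr0 ?expr1n//.
by move=> i /negbTE i0; rewrite mxE i0 andbF expr0n.
Qed.

End Sphere.

(** The distance between the images of antipodes attains its minimum on the compact sphere, as the
    opposite of the maximum of [m]; injectivity makes it nonzero because [y != - y]. *)
Lemma antipodal_gap (R : realType) (n : nat) (V : normedModType R)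
    (g : 'rV[R]_n.+1 -> V) :
  {within sphere R n, continuous g} -> set_inj (sphere R n) g ->
  exists2 d, 0 < d & forall y, sphere R n y -> d <= `|g y - g (- y)|.
Proof.
move=> gc ginj; pose m y := - `|g y - g (- y)|.
have gS : forall x, sphere R n x -> g y @[y --> within (sphere R n) (nbhs x)] --> g x.
  by move/subspace_continuousP: gc.
have mc : {within sphere R n, continuous m}.
  apply/subspace_continuousP => x xS; apply: cvgN; apply: cvg_norm.
  apply: cvgB; first exact: gS.
  have xN : - y @[y --> within (sphere R n) (nbhs x)] -->
      within (sphere R n) (nbhs (- x)).
    apply: (@cvg_withinP _ _ _ _ (fun y : 'rV[R]_n.+1 => - y)).
      exact: opp_continuous.
    exact: sphere_opp.
  by move=> P /(gS _ (sphere_opp xS))/xN.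
have [c cS cm] := compact_EVT_max (@sphere_nonempty R n) (@sphere_compact R n) mc.
move: cS; rewrite inE => cS.
exists `|g c - g (- c)|.
  rewrite normr_gt0 subr_eq0; apply: contra (sphere_opp_neq cS) => /eqP gg.
  by apply/eqP/ginj => //; rewrite inE//; exact: sphere_opp.
by move=> y yS; rewrite -lerN2; apply: cm; rewrite inE.
Qed.

(** * Spheres of targets are not learnable *)

Lemma cvg_half_sqnorm (R : realType) (V : normedModType R) (T : Type)
    (F : set_system T) (FF : Filter F) (y : T -> V) (l : V) :
  y t @[t --> F] --> l ->
  2^-1 * `|y t| ^+ 2 @[t --> F] --> 2^-1 * `|l| ^+ 2.
Proof.
move=> yl; apply: cvgMr; rewrite expr2; under eq_fun do rewrite expr2.
by apply: cvgM; exact: cvg_norm yl.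
Qed.

Lemma cvg_locally_lipschitz (R : realType) (U V : normedModType R) (T : Type)
    (F : set_system T) (FF : Filter F) (f : T -> U) (h : T -> V) l m (C : R) :
  0 <= C -> f t @[t --> F] --> l ->
  (forall t, `|l - f t| <= 1 -> `|m - h t| <= C * `|l - f t|) ->
  h t @[t --> F] --> m.
Proof.
move=> C0 /cvgrPdist_le fl hm; apply/cvgrPdist_le => e e0.
have C1 : 0 < C + 1 by rewrite ltr_wpDl.
apply: filterS2 (fl _ ltr01) (fl _ (divr_gt0 e0 C1)) => t t1.
rewrite ler_pdivlMr// mulrDr mulr1 mulrC => t2; apply: le_trans (hm t t1) _.
by apply: le_trans t2; rewrite lerDl.
Qed.

Theorem theorem3 (R : realType) (W : nat) (V : completeNormedModType R)
  (HV : hilbert_norm V) (HW : (1 <= W)%N)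
  (Phi : 'rV[R]_W -> V)
  (Phi_diff : forall w, differentiable Phi w)
  (Phi_lip : exists k : R, forall w1 w2 v : 'rV[R]_W,
      `|'d Phi w1 v - 'd Phi w2 v| <= k * `|w1 - w2| * `|v|)
  (g : 'rV[R]_(W.+1) -> V)
  (g_cont : {within sphere R W, continuous g})
  (g_inj : set_inj (sphere R W) g) :
  ~ (g @` sphere R W `<=` GF_learnable Phi).
Proof.
have [inner [innerC inner_lin inner_norm]] := HV.
have [k Phi_lipk] := Phi_lip; move=> learn.
pose L f := loss Phi f; pose E := 'rV[R]_W.
have grlip := grad_loss_lipschitz innerC inner_lin inner_norm Phi_diff Phi_lipk.
have Phic : continuous Phi by move=> u; exact: differentiable_continuous.
have L_ge0 f u : 0 <= L f u by rewrite mulr_ge0 ?sqr_ge0.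
have L_cont f : continuous (L f).
  move=> u; have fu : f - Phi v @[v --> u] --> f - Phi u.
    exact: (cvgB (cvg_cst f) (Phic u)).
  exact: cvg_half_sqnorm fu.
have L_chain f (w : R -> E) (t : R) dw (wd : is_derive t 1 w dw) :=
  is_derive_loss_curve innerC inner_lin inner_norm Phi_diff f wd.
have L_lip f (B : R) : 0 <= B -> exists2 K, 0 <= K & forall u v, `|u| <= B ->
    `|v| <= B -> `|grad (L f) u - grad (L f) v| <= K * `|u - v|.
  move=> B0; have [K K0 KP] := grlip B `|f| B0 (normr_ge0 f); exists K => // u v uB vB.
  by have := KP f f u v (lexx _) (lexx _) uB vB; rewrite subrr normr0 addr0.
have [w wP] := choice (fun f =>
  gradient_flow_exists (L_ge0 f) (@L_cont f) (@L_chain f) (@L_lip f)).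
(* Learnability speaks of every solution, so it applies to the trajectories just chosen. *)
have w_sol f : GF_solution Phi f (w f).
  have [w0 wc wd _] := wP f; split => //.
  by apply: cvg_at_right_filter; exact: wc.
have w_dec f s t : 0 <= s <= t -> L f (w f t) <= L f (w f s).
  have [_ wc wd _] := wP f.
  exact: (flow_nonincreasing (@L_cont f) (@L_chain f) wc wd).
(* Targets within 1 of [f] have norm at most [M] and initial loss at most [l], so up to time [T]
   their trajectories stay within radius [B], where the gradient is Lipschitz in target and
   parameter; the Gronwall bound then applies. *)
have w_lip f T : 0 <= T -> exists2 C, 0 <= C & forall f', `|f - f'| <= 1 ->
    `|w f T - w f' T| <= C * `|f - f'|.
  move=> T0; pose M := `|f| + 1.
  have M0 : 0 <= M by rewrite addr_ge0.
  pose l := 2^-1 * (M + `|Phi 0|) ^+ 2.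
  have l0 : 0 <= l by rewrite mulr_ge0 ?sqr_ge0.
  pose B := 1 + 2 * expR T * l.
  have B0 : 0 <= B by rewrite addr_ge0// mulr_ge0// mulr_ge0// expR_ge0.
  have [K K0 KP] := grlip B M B0 M0; have [C C0 CP] := gronwall_curves W K0 T0.
  exists C => // f' ff'.
  have wB f1 t : `|f1| <= M -> 0 <= t <= T -> `|w f1 t| <= B.
    move=> f1M /andP[t0 tT]; have [_ _ _ wb] := wP f1; apply: le_trans (wb t t0) _.
    rewrite lerD2l; apply: ler_pM; rewrite ?mulr_ge0 ?expR_ge0//.
      by rewrite ler_pM2l// ler_expR.
    rewrite /L /loss ler_wpM2l// ler_pXn2r ?nnegrE ?addr_ge0//.
    by apply: le_trans (ler_normB _ _) _; rewrite lerD2r.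
  have fM : `|f| <= M by rewrite lerDl.
  have f'M : `|f'| <= M.
    by apply: le_trans (ler_norm_addB f' f) _; rewrite lerD2l distrC.
  have [w0 wc wd _] := wP f; have [w0' wc' wd' _] := wP f'.
  apply: (CP _ _ (fun t => - grad (L f) (w f t)) (fun t => - grad (L f') (w f' t))) => //.
    by rewrite w0 w0'.
  move=> t /andP[t0 tT]; rewrite -opprD normrN.
  by apply: KP => //; apply: wB => //; rewrite !ltW.
have wg_cont T : 0 <= T -> forall y, sphere R W y ->
    w (g z) T @[z --> within (sphere R W) (nbhs y)] --> w (g y) T.
  move=> T0 y yS; have gy : g z @[z --> within (sphere R W) (nbhs y)] --> g y.
    by move/subspace_continuousP: g_cont; exact.
  have [C C0 CP] := w_lip (g y) T T0.
  exact: cvg_locally_lipschitz C0 gy (fun z => CP (g z)).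
have uniform_time (e : R) : 0 < e -> exists N : nat,
    forall y, sphere R W y -> L (g y) (w (g y) N%:R) < e.
  (* If points [y N] have loss at least [e] at time [N], they cluster at some [p]. The loss for
     [g p] is below [e] at some time [t], hence also for nearby targets at the same [t], and by
     monotonicity at every later [N]. *)
  move=> e0; apply: contrapT => /forallNP late.
  have /choice[y yP] : forall N : nat, exists y, sphere R W y /\
      e <= L (g y) (w (g y) N%:R).
    move=> N; have /existsNP[y /not_implyP[yS /negP]] := late N.
    by rewrite -leNgt => ye; exists y.
  have [p pS py] := compact_cluster_seq (@sphere_compact R W) (fun N => (yP N).1).
  have infp := learn (g p) (ex_intro2 _ _ p pS erefl) (w (g p)) (w_sol (g p)).
  have [t t0 te] : exists2 t, 0 <= t & L (g p) (w (g p) t) < e.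
    have hinf : has_inf [set L (g p) (w (g p) t) | t in [set t : R | 0 <= t]].
      split; first by exists (L (g p) (w (g p) 0)), 0 => //=.
      by exists 0 => _ [t _ <-].
    have [_ [t t0 <-]] := inf_adherent e0 hinf.
    by rewrite infp add0r => te; exists t.
  have near_t : \forall z \near within (sphere R W) (nbhs p),
      L (g z) (w (g z) t) < e.
    have Lz : L (g z) (w (g z) t) @[z --> within (sphere R W) (nbhs p)] -->
        L (g p) (w (g p) t).
      have gp : g z @[z --> within (sphere R W) (nbhs p)] --> g p.
        by move/subspace_continuousP: g_cont; exact.
      have Pp : Phi (w (g z) t) @[z --> within (sphere R W) (nbhs p)] -->
          Phi (w (g p) t).
        exact: continuous_cvg (Phic _) (wg_cont t t0 p pS).
      exact: cvg_half_sqnorm (cvgB gp Pp).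
    exact: cvgr_lt Lz _ te.
  have [N tN] := py (Num.truncn t).+1 _ near_t.
  have [yS ye] := yP N => /(_ yS); rewrite ltNge => /negP; apply.
  apply: le_trans ye _; apply: w_dec; rewrite t0 /=.
  apply: le_trans (ltW (truncnS_gt t)) _; by rewrite ler_nat.
have [d d0 dP] := antipodal_gap g_cont g_inj.
(* A loss below this value puts the target within [d / 2] of [Phi u]; two such targets with the same
   [u] are then closer than [d]. *)
have e0 : 0 < 2^-1 * (d / 2) ^+ 2 by rewrite mulr_gt0 ?exprn_gt0 ?divr_gt0.
have [N NP] := uniform_time _ e0.
have [|y yS hy] := @borsuk_ulam R W (fun y => w (g y) N%:R).
  by apply/subspace_continuousP; exact: wg_cont.
have yNS := sphere_opp yS.
have close f u : L f u < 2^-1 * (d / 2) ^+ 2 -> `|f - Phi u| < d / 2.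
  rewrite /L /loss ltr_pM2l ?invr_gt0// ltr_pXn2r ?nnegrE// ?divr_ge0 ?ltW//.
have h1 := close _ _ (NP y yS); have := close _ _ (NP (- y) yNS).
rewrite -hy distrC => h2; have := dP y yS; rewrite leNgt => /negP; apply.
rewrite -(subrKA (Phi (w (g y) N%:R))); apply: le_lt_trans (ler_normD _ _) _.
by rewrite [ltRHS](splitr d) ltrD.
Qed.
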